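(* Let $m$ be an odd positive integer, let $(\pi,V)$ be a representation of $D_m$ with character $\chi_\pi$, and let $t_\pi=\frac12(\chi_\pi(1)-\chi_\pi(s))$. Then $\pi$ lifts to (i) $\widetilde{\mathrm{O}}(V)$ if and only if $t_\pi$ is even; (ii) $\mathrm{Pin}^+(V)$ if and only if $t_\pi\equiv 0$ or $1\pmod 4$; (iii) $\mathrm{Pin}^-(V)$ if and only if $t_\pi\equiv 0$ or $3\pmod 4$.
   Context: Representations are finite-dimensional complex representations. $D_m=\langle r,s\mid r^m=1,\ s^2=1,\ rs=sr^{-1}\rangle$ is the dihedral group of order $2m$. Every representation of $D_m$ is orthogonal, i.e. preserves a nondegenerate quadratic form $Q$ on its space $V$, so it gives a homomorphism $\pi:D_m\to\mathrm{O}(V)$. Double covers of $\mathrm{O}(V)$: $\widetilde{\mathrm{O}}(V)=\{(g,z)\in \mathrm{O}(V)\times C_4:\det g=z^2\}$, where $C_4\subset\mathbb{C}^\times$ is generated by the imaginary unit, with projection $(g,z)\mapsto g$. Let $C(V)$ be the Clifford algebra, the quotient of the tensor algebra $T(V)$ by the two-sided ideal generated by $\{v\otimes v-Q(v):v\in V\}$. $\mathrm{Pin}^+(V)$ (resp. $\mathrm{Pin}^-(V)$) is the subgroup of $C(V)^\times$ generated by the $u\in V$ with $Q(u)=1$ (resp. $Q(u)=-1$); the covering map to $\mathrm{O}(V)$ sends each such $u$ to the reflection in the hyperplane orthogonal to $u$, with kernel $\{\pm1\}$. ''$\pi$ lifts to $E$'' means there is a homomorphism $D_m\to E$ whose composition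 with the covering $E\to\mathrm{O}(V)$ is $\pi$. Known cohomological criterion, where $w_i(\pi)\in H^i(\cdot,\mathbb{Z}/2\mathbb{Z})$ are the Stiefel-Whitney classes of $\pi$ (pullbacks of the universal classes on $B\mathrm{O}(V)$): an orthogonal representation $\pi$ of a finite group lifts to $\widetilde{\mathrm{O}}(V)$ iff $w_1(\pi)^2=0$, to $\mathrm{Pin}^+(V)$ iff $w_2(\pi)=0$, and to $\mathrm{Pin}^-(V)$ iff $w_2(\pi)+w_1(\pi)^2=0$. *)

(* Defs.v *)
From HB Require Import structures.
From mathcomp Require Import all_boot all_order all_algebra all_fingroup.
From mathcomp Require Import mxrepresentation.
From mathcomp Require Import generic_quotient ring_quotient.
From mathcomp Require Import boolp reals complex.
From mathcomp Require Import monalg.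

Set Implicit Arguments.
Unset Strict Implicit.
Unset Printing Implicit Defensive.

Import GRing.Theory.
Local Open Scope ring_scope.
Local Open Scope quotient_scope.

(* The relations bound the order of [<<r, s>>] by 2m, so the condition on the
   order says that they present [G]; this also covers m = 1 and m = 2. *)
Definition is_dihedral (m : nat) (gT : finGroupType) (G : {group gT})
    (r s : gT) : Prop :=
  [/\ G :=: <<[set r; s]>>%g, (r ^+ m = 1)%g, (s ^+ 2 = 1)%g,
      (r * s = s * r^-1)%g & #|G| = m.*2].

(* [t] is an integer congruent to [a] modulo [d]. *)
Definition int_congr (K : pzRingType) (d : nat) (a : int) (t : K) : Prop :=
  exists k : int, t = (a + k * d%:Z)%:~R.

(** Quadratic spaces: V = 'cV[K]_n, on which matrices act on the left. In
    characteristic different from 2, a nondegenerate quadratic form is given by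
    the (unique) invertible symmetric matrix of its polar form. *)

Section QuadraticSpace.
Variables (K : fieldType) (n : nat).
Implicit Types (B g : 'M[K]_n) (u v : 'cV[K]_n).

Definition nondeg_sym B : Prop := B^T = B /\ B \in unitmx.

Definition qform B v : K := (v^T *m B *m v) 0 0.

Definition orthogonal_mx B g : Prop :=
  g \in unitmx /\ forall v, qform B (g *m v) = qform B v.

(* v |-> v - 2 B(u, v) / Q(u) *: u, for u anisotropic *)
Definition reflection B u : 'M[K]_n :=
  1%:M - (2 / qform B u) *: (u *m u^T *m B).

End QuadraticSpace.

(** T(V): the basis e_i of 'cV[K]_n gives V^{(x)k} the basis of the words of
    length k in 'I_n, with concatenation as product; hence T(V) is the algebra
    over K of the free monoid on 'I_n. *)

Definition word (n : nat) : Type := seq 'I_n.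
HB.instance Definition _ n := Choice.on (word n).

Fact word_unitm n (x y : word n) : x ++ y = [::] -> x = [::] /\ y = [::].
Proof. by case: x y => [|? ?] []. Qed.

HB.instance Definition _ n := Choice_isMonomialDef.Build (word n)
  (@catA 'I_n) (@cat0s 'I_n) (@cats0 'I_n) (@word_unitm n).

Notation tensor_alg K n := {malg K[word n]}.

Section Clifford.
Variables (K : fieldType) (n : nat).
Implicit Types (B : 'M[K]_n) (v : 'cV[K]_n).

Definition tensor_vec v : tensor_alg K n :=
  \sum_(i < n) << v i 0 *g ([:: i] : word n) >>.

Definition clifford_rel B v : tensor_alg K n :=
  tensor_vec v * tensor_vec v - (qform B v)%:MP.

Definition in_clifford_ideal B (x : tensor_alg K n) : Prop :=
  exists l : seq (tensor_alg K n * 'cV[K]_n * tensor_alg K n),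
    x = \sum_(a <- l) a.1.1 * clifford_rel B a.1.2 * a.2.

Definition clifford_ideal B : {pred tensor_alg K n} :=
  fun x => `[< in_clifford_ideal B x >].

Lemma clifford_ideal_zmod B : zmod_closed (clifford_ideal B).
Proof.
split=> [|x y /asboolP[l ->] /asboolP[k ->]]; apply/asboolP.
  by exists [::]; rewrite big_nil.
exists (l ++ [seq (- a.1.1, a.1.2, a.2) | a <- k]).
rewrite big_cat big_map -sumrN; congr (_ + _).
by apply: eq_bigr => a _ /=; rewrite !mulNr.
Qed.

HB.instance Definition _ B :=
  GRing.isZmodClosed.Build (tensor_alg K n) (clifford_ideal B)
    (clifford_ideal_zmod B).

Lemma clifford_idealMl B y x : x \in clifford_ideal B -> y * x \in clifford_ideal B.
Proof.
move=> /asboolP[l ->]; apply/asboolP.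
exists [seq (y * a.1.1, a.1.2, a.2) | a <- l]; rewrite big_map mulr_sumr.
by apply: eq_bigr => a _; rewrite !mulrA.
Qed.

Lemma clifford_idealMr B y x : x \in clifford_ideal B -> x * y \in clifford_ideal B.
Proof.
move=> /asboolP[l ->]; apply/asboolP.
exists [seq (a.1.1, a.1.2, a.2 * y) | a <- l]; rewrite big_map mulr_suml.
by apply: eq_bigr => a _; rewrite !mulrA.
Qed.

Definition clifford B : Type :=
  Quotient.quot (clifford_ideal B : zmodClosed (tensor_alg K n)).

HB.instance Definition _ B := GRing.Zmodule.on (clifford B).
HB.instance Definition _ B := ZmodQuotient.on (clifford B).

Definition clifford_one B : clifford B := \pi_(clifford B) 1.
Definition clifford_mul B (x y : clifford B) : clifford B :=
  \pi_(clifford B) (repr x * repr y).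

Lemma clifford_piP B (x y : tensor_alg K n) :
  reflect (\pi_(clifford B) x = \pi y) (x - y \in clifford_ideal B).
Proof. by rewrite [_ \in _]Quotient.idealrBE; apply: eqP. Qed.

Lemma clifford_piM B :
  {morph \pi_(clifford B) : x y / x * y >-> clifford_mul x y}.
Proof.
move=> x y; apply/clifford_piP; set x' := repr _; set y' := repr _.
have -> : x * y - x' * y' = (x - x') * y + x' * (y - y').
  by rewrite mulrBl mulrBr addrA subrK.
apply: rpredD; [apply: clifford_idealMr | apply: clifford_idealMl];
  by apply/clifford_piP; rewrite reprK.
Qed.

Lemma clifford_mulA B : associative (@clifford_mul B).
Proof.
elim/quotW=> x; elim/quotW=> y; elim/quotW=> z.
by rewrite -(clifford_piM _ y z) -(clifford_piM _ x y) -!clifford_piM mulrA.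
Qed.

Lemma clifford_mul1l B : left_id (clifford_one B) (@clifford_mul B).
Proof. by elim/quotW=> x; rewrite -clifford_piM mul1r. Qed.

Lemma clifford_mul1r B : right_id (clifford_one B) (@clifford_mul B).
Proof. by elim/quotW=> x; rewrite -clifford_piM mulr1. Qed.

Lemma clifford_mulDl B : left_distributive (@clifford_mul B) +%R.
Proof.
elim/quotW=> x; elim/quotW=> y; elim/quotW=> z.
by rewrite -raddfD -(clifford_piM _ x z) -(clifford_piM _ y z) -!clifford_piM mulrDl raddfD.
Qed.

Lemma clifford_mulDr B : right_distributive (@clifford_mul B) +%R.
Proof.
elim/quotW=> x; elim/quotW=> y; elim/quotW=> z.
by rewrite -raddfD -(clifford_piM _ x y) -(clifford_piM _ x z) -!clifford_piM mulrDr raddfD.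
Qed.

(* Only a possibly trivial ring, since 1 <> 0 is a theorem. *)
HB.instance Definition _ B := GRing.Zmodule_isPzRing.Build (clifford B)
  (@clifford_mulA B) (@clifford_mul1l B) (@clifford_mul1r B)
  (@clifford_mulDl B) (@clifford_mulDr B).

Definition clifford_vec B v : clifford B := \pi_(clifford B) (tensor_vec v).

Lemma clifford_vec_sqr B v :
  clifford_vec B v * clifford_vec B v = \pi_(clifford B) (qform B v)%:MP.
Proof.
rewrite -[LHS]clifford_piM; apply/clifford_piP/asboolP.
by exists [:: (1, v, 1)]; rewrite big_seq1 mul1r mulr1.
Qed.

End Clifford.

(** Double covers of O(V) *)

(* The subgroup of the group of units of [A] generated by a set [S] of units *)
Inductive unit_subgroup (A : pzRingType) (S : A -> Prop) : A -> Prop :=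
| unit_subgroup_gen x of S x : unit_subgroup S x
| unit_subgroup1 : unit_subgroup S 1
| unit_subgroupM x y of unit_subgroup S x & unit_subgroup S y :
    unit_subgroup S (x * y)
| unit_subgroupV x y of unit_subgroup S x & x * y = 1 & y * x = 1 :
    unit_subgroup S y.

Section Covers.
Variables (K : fieldType) (n : nat) (B : 'M[K]_n).

(* Pin^+(V) for [e = 1], Pin^-(V) for [e = -1] *)
Definition pin (e : K) : clifford B -> Prop :=
  unit_subgroup (fun x => exists2 u, qform B u = e & x = clifford_vec B u).

(* This determines [p] on [pin e], which the vectors u generate. *)
Definition pin_covering (e : K) (p : clifford B -> 'M[K]_n) : Prop :=
  [/\ forall x, pin e x -> orthogonal_mx B (p x),
      forall x y, pin e x -> pin e y -> p (x * y) = p x *m p y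
    & forall u, qform B u = e -> p (clifford_vec B u) = reflection B u].

End Covers.

Definition mu4 (R : realType) (z : R[i]) : Prop := exists k : nat, z = 'i%C ^+ k.

Definition O_tilde (R : realType) (n : nat) (B : 'M[R[i]]_n)
    (x : 'M[R[i]]_n * R[i]) : Prop :=
  [/\ orthogonal_mx B x.1, mu4 x.2 & \det x.1 = x.2 ^+ 2].

Definition O_tilde_mul (K : fieldType) (n : nat) (x y : 'M[K]_n * K) :
  'M[K]_n * K := (x.1 *m y.1, x.2 * y.2).

(** Lifting of representations; a group E is given by its carrier in a type
    with a product. *)

Section Lifts.
Variables (K : fieldType) (n : nat) (gT : finGroupType) (G : {group gT}).
Variable rG : mx_representation K G n.

Definition lifts (A : Type) (mul : A -> A -> A) (E : A -> Prop)
    (p : A -> 'M[K]_n) : Prop :=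
  exists phi : gT -> A,
    [/\ {in G, forall g, E (phi g)},
        {in G &, forall g h, phi (g * h)%g = mul (phi g) (phi h)}
      & {in G, forall g, p (phi g) = rG g}].

Definition lifts_pin (B : 'M[K]_n) (e : K) : Prop :=
  exists2 p : clifford B -> 'M[K]_n, pin_covering e p & lifts *%R (pin e) p.

End Lifts.

Definition lifts_O_tilde (R : realType) (n : nat) (gT : finGroupType)
    (G : {group gT}) (rG : mx_representation R[i] G n) (B : 'M[R[i]]_n) : Prop :=
  lifts rG (@O_tilde_mul _ n) (O_tilde B) fst.

(* Main.v *)
(* An orthogonal involution with a (-1)-eigenspace of dimension [t] is the product
   of the reflections in an orthogonal basis [u_1, ..., u_t] of that eigenspace
   with [Q(u_i) = e]. In Pin, the elements over it are [u_1 ... u_t] and its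
   opposite, both of square [(-1)^(t(t-1)/2) e^t]; so [t mod 4] decides whether
   [pi(s)] lifts to an element of square 1, which is necessary for [pi] to lift.
   Conversely, [r = s (s r)] is a product of two involutions, so [pi(r)] lifts to
   Pin; as [m] is odd, a suitable power of the lift has order dividing [m], and
   the relation [(s r)^2 = 1], which holds up to a sign in Pin, holds exactly
   because its sign is detected by an odd power [m].
   That the kernel of Pin -> O(V) is {1, -1} is shown by expanding products of
   vectors in words of an orthonormal basis. That a covering map exists at all
   needs the embedding of V in C(V) and the grading of C(V), both visible in the
   Fock representation. *)

Require Import Defs.
From HB Require Import structures.
From mathcomp Require Import all_boot all_order all_algebra all_fingroup.
From mathcomp Require Import cyclic mxrepresentation.
From mathcomp Require Import generic_quotient boolp reals complex.
From mathcomp Require Import monalg ring zify.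

Set Implicit Arguments.
Unset Strict Implicit.
Unset Printing Implicit Defensive.

Import GRing.Theory Num.Theory.
Local Open Scope ring_scope.

(** * The Fock representation of the Clifford algebra *)

Lemma malgUU (K : fieldType) (M : monomType) (a b : K) (x y : M) :
  << a *g x >> * << b *g y >> = << a * b *g mmul x y >> :> {malg K[M]}.
Proof. by rewrite malgM_def fgmulUU. Qed.

Section CliffordRep.
Local Open Scope quotient_scope.
Variables (K : fieldType) (n : nat) (B : 'M[K]_n).

(** The structure map of [K] into C(V). As [clifford B] is only given as a ring, scalars act through
    multiplication by these central elements. *)
Definition clifford_scal (c : K) : clifford B := \pi_(clifford B) c%:MP.

Lemma clifford_mul_pi (x y : tensor_alg K n) :
  \pi_(clifford B) x * \pi_(clifford B) y = \pi_(clifford B) (x * y).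
Proof. by rewrite clifford_piM. Qed.

Lemma clifford_scal_additive : additive clifford_scal.
Proof. by move=> x y; rewrite /clifford_scal !raddfB. Qed.

Lemma clifford_scal_monoid : monoid_morphism clifford_scal.
Proof.
split=> [|x y]; first by rewrite /clifford_scal rmorph1.
by rewrite /clifford_scal rmorphM clifford_piM.
Qed.

HB.instance Definition _ :=
  GRing.isAdditive.Build K (clifford B) clifford_scal clifford_scal_additive.
HB.instance Definition _ :=
  GRing.isMonoidMorphism.Build K (clifford B) clifford_scal clifford_scal_monoid.

Lemma tensor_vec_linear : linear (@tensor_vec K n).
Proof.
move=> a u v; rewrite /tensor_vec scaler_sumr -big_split; apply: eq_bigr => i _.
rewrite !mxE monalgUD; congr (_ + _).
by rewrite -mul_malgC malgUU mul1m.
Qed.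

HB.instance Definition _ :=
  GRing.isLinear.Build K 'cV[K]_n (tensor_alg K n) _ (@tensor_vec K n)
    tensor_vec_linear.

Lemma clifford_vec_additive : additive (@clifford_vec K n B).
Proof. by move=> u v; rewrite /clifford_vec !raddfB. Qed.

HB.instance Definition _ :=
  GRing.isAdditive.Build 'cV[K]_n (clifford B) (@clifford_vec K n B)
    clifford_vec_additive.

Lemma clifford_vecZ a v :
  clifford_vec B (a *: v) = clifford_scal a * clifford_vec B v.
Proof.
by rewrite /clifford_vec linearZ /= -mul_malgC -clifford_mul_pi.
Qed.

Lemma clifford_vec_sqrE v :
  clifford_vec B v * clifford_vec B v = clifford_scal (qform B v).
Proof. exact: clifford_vec_sqr. Qed.

Lemma clifford_scalC c (x : clifford B) :
  clifford_scal c * x = x * clifford_scal c.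
Proof.
elim/quotW: x => x; rewrite !clifford_mul_pi; congr (\pi _).
rewrite mul_malgC [in RHS](monalgE x) [in LHS](monalgE x).
rewrite scaler_sumr mulr_suml; apply: eq_bigr => k _.
by rewrite -mul_malgC !malgUU mul1m mulm1 mulrC.
Qed.

Lemma clifford_scalMM c d (x y : clifford B) :
  clifford_scal c * x * (clifford_scal d * y) = clifford_scal (c * d) * (x * y).
Proof.
rewrite rmorphM /= (mulrA (_ * x)) -(mulrA (clifford_scal c) x) -clifford_scalC.
by rewrite (mulrA (clifford_scal c)) -(mulrA (_ * _) x).
Qed.

(** The universal property of C(V). T(V) is free on the basis vectors, so [g] extends to it by
    evaluating words; the extension kills the generators of the ideal by [g_sqr] and hence factors
    through the quotient. *)
Lemma clifford_lift (S : algType K) (g : {linear 'cV[K]_n -> S}) :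
    (forall v, g v * g v = (qform B v)%:A) ->
  exists rho : {rmorphism clifford B -> S}, forall v, rho (clifford_vec B v) = g v.
Proof.
move=> g_sqr.
pose h (w : word n) : S := \prod_(i <- w) g (delta_mx i 0).
have hmon : mmorphism h.
  by split=> [x y|]; rewrite /h ?big_nil // /mmul /= big_cat.
pose hM : {mmorphism word n -> S} :=
  HB.pack h (monalg.isMultiplicative.Build _ _ h hmon).
pose F : {additive tensor_alg K n -> S} := mmap (in_alg S) hM.
have F_mul : monoid_morphism F.
  have [FM F1] : GRing.multiplicative F.
    apply: commr_mmap_is_multiplicative => x m m' /=.
    by rewrite /GRing.comm /= -scalerAl -scalerAr mul1r mulr1.
  by split.
have F_vec v : F (tensor_vec v) = g v.
  rewrite /tensor_vec raddf_sum [in RHS](matrix_sum_delta v) linear_sum /=.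
  apply: eq_bigr => i _; rewrite big_ord1 linearZ /F /= mmapU /= /h big_seq1.
  by rewrite -scalerAl mul1r.
have F_ideal x : x \in clifford_ideal B -> F x = 0.
  move=> /asboolP[l ->]; rewrite raddf_sum big1 // => -[[y v] z] _ /=.
  rewrite !F_mul.2 /clifford_rel raddfB F_mul.2 F_vec g_sqr.
  by rewrite [F _%:MP]mmapC subrr mulr0 mul0r.
pose rho (x : clifford B) := F (repr x).
have rho_pi x : rho (\pi x) = F x.
  apply/eqP; rewrite -subr_eq0 -raddfB; apply/eqP/F_ideal/clifford_piP.
  by rewrite reprK.
have rho_add : additive rho.
  by elim/quotW=> x; elim/quotW=> y; rewrite -raddfB !rho_pi raddfB.
have rho_mul : monoid_morphism rho.
  split=> [|]; first by rewrite -[1]/(\pi 1) rho_pi F_mul.1.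
  by elim/quotW=> x; elim/quotW=> y; rewrite clifford_mul_pi !rho_pi F_mul.2.
pose rhoM : {rmorphism clifford B -> S} :=
  HB.pack rho (GRing.isAdditive.Build _ _ rho rho_add)
    (GRing.isMonoidMorphism.Build _ _ rho rho_mul).
by exists rhoM => v; rewrite /= /clifford_vec rho_pi F_vec.
Qed.

End CliffordRep.

(* The Fock representation: creation operators [C] and annihilation operators
   [A] of the exterior algebra, with its grading operator [w]. *)
Lemma fock_space (K : comNzRingType) n :
  exists d (C A : 'cV[K]_n -> 'M[K]_d) (w : 'M[K]_d),
  [/\ (0 < d)%N, linear C, linear A & w *m w = 1%:M] /\
  [/\ forall v, w *m C v = - (C v *m w), forall v, w *m A v = - (A v *m w),
      forall v, C v *m C v = 0, forall v, A v *m A v = 0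
    & forall u v, C u *m A v + A v *m C u = ((v^T *m u) 0 0)%:M].
Proof.
elim: n => [|n [d [C [A [w [[d_gt0 linC linA ww] [wC wA CC AA CA]]]]]]].
  exists 1, (fun=> 0), (fun=> 0), 1%:M; split; split; rewrite ?mulmx1 //.
  1,2: by move=> a u v; rewrite scaler0 addr0.
  1,2: by move=> v; rewrite mulmx0 oppr0.
  1,2: by move=> v; rewrite mulmx0.
  by move=> u v; rewrite mulmx0 addr0 mxE big_ord0 raddf0.
pose hd (v : 'cV[K]_n.+1) := v 0 0; pose tl (v : 'cV[K]_(1 + n)) := dsubmx v.
(* With e_0 the new basis vector, the exterior algebra splits as L + e_0 L, where L is that of the
   remaining coordinates. The lower right blocks carry a sign because e_0 anticommutes with the
   other vectors and shifts the degree by one. *)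
exists (d + d)%N, (fun v => block_mx (C (tl v)) 0 (hd v)%:M (- C (tl v))),
  (fun v => block_mx (A (tl v)) (hd v)%:M 0 (- A (tl v))), (block_mx w 0 0 (- w)).
have tlD a u v : tl (a *: u + v) = a *: tl u + tl v by rewrite /tl linearP.
have hdD a u v : hd (a *: u + v) = a * hd u + hd v by rewrite /hd !mxE.
split; split.
- by rewrite addn_gt0 d_gt0.
- move=> a u v; rewrite tlD hdD linC scale_block_mx add_block_mx.
  by rewrite scaler0 addr0 opprD scalerN raddfD /= scale_scalar_mx.
- move=> a u v; rewrite tlD hdD linA scale_block_mx add_block_mx.
  by rewrite scaler0 addr0 opprD scalerN raddfD /= scale_scalar_mx.
- by rewrite mulmx_block !mulmx0 !mul0mx !addr0 !add0r mulmxN mulNmx opprK ww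
  -scalar_mx_block.
all: move=> u.
- rewrite !mulmx_block !mulmx0 !mul0mx !addr0 !add0r opp_block_mx oppr0.
  by rewrite !mulNmx !mulmxN wC mul_mx_scalar mul_scalar_mx.
- rewrite !mulmx_block !mulmx0 !mul0mx !addr0 !add0r opp_block_mx oppr0.
  rewrite !mulNmx !mulmxN wA mul_mx_scalar mul_scalar_mx. by rewrite !opprK.
- rewrite !mulmx_block !mulmx0 !mul0mx !addr0 !add0r CC.
  by rewrite !mulNmx !mulmxN CC opprK mul_mx_scalar mul_scalar_mx ?scalerN subrr
    ?oppr0 block_mx0.
- rewrite !mulmx_block !mulmx0 !mul0mx !addr0 !add0r AA.
  by rewrite !mulNmx !mulmxN AA opprK mul_mx_scalar mul_scalar_mx ?scalerN subrr
    ?oppr0 block_mx0.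
- move=> v.
  rewrite !mulmx_block add_block_mx !mulmx0 !mul0mx !addr0 !add0r.
  rewrite !mul_scalar_mx !mul_mx_scalar !scalerN !mulNmx !mulmxN !opprK.
  have -> : (v^T *m u) 0 0 = hd v * hd u + ((tl v)^T *m tl u) 0 0.
    rewrite !mxE big_ord_recl !mxE; congr (_ + _).
    by apply: eq_bigr => i _; rewrite !mxE !rshift1.
  rewrite !subrr [X in block_mx X]addrA CA -[X in block_mx _ _ _ X]addrA CA.
  rewrite !scale_scalar_mx [hd u * _]mulrC -!raddfD /= [_ + hd v * _]addrC.
  by rewrite -scalar_mx_block.
Qed.

(* [rho] sends [v] to [C v + A (B v)], whose square is the anticommutator of
   [C v] and [A (B v)]. *)
Lemma clifford_fock (K : fieldType) n (B : 'M[K]_n) :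
  exists d (rho : {rmorphism clifford B -> 'M[K]_d.+1}) (w : 'M[K]_d.+1),
  [/\ w * w = 1,
      forall v, w * rho (clifford_vec B v) = - (rho (clifford_vec B v) * w)
    & forall v, rho (clifford_vec B v) = 0 -> v = 0].
Proof.
have [d [C [A [w [[]]]]]] := fock_space K n.
case: d C A w => // d C A w _ linC linA ww [wC wA CC AA CA].
pose g v := C v + A (B *m v).
have g_lin : linear g.
  by move=> a u v; rewrite /g linC linearP linA scalerDr addrACA.
pose gL : {linear 'cV[K]_n -> 'M[K]_d.+1} :=
  HB.pack g (GRing.isLinear.Build _ _ _ _ g g_lin).
have g_sqr v : gL v * gL v = (qform B v)%:A.
  rewrite /= /g -mulmxE mulmxDl !mulmxDr CC AA add0r addr0 CA -scalemx1 /qform.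
  by congr (_ *: _); rewrite -[in RHS](trmxK (_ *m v)) [RHS]mxE !trmx_mul trmxK
    mulmxA.
have [rho rhoE] := clifford_lift g_sqr.
exists d, rho, w; split=> [|v|v]; rewrite -?mulmxE ?rhoE //=.
  by rewrite /g mulmxDl mulmxDr wC wA opprD.
move=> gv0; apply/colP=> i; rewrite mxE.
(* The anticommutator of [g v] with the annihilation operator of e_i is the i-th coordinate of [v]:
   the summand [A (B v)] contributes nothing, by polarization of [AA]. So [g v = 0] forces
   [v = 0]. *)
have AA2 x y : A x *m A y + A y *m A x = 0.
  have := AA (1 *: x + y); rewrite linA scale1r mulmxDl !mulmxDr !AA.
  by rewrite add0r addr0.
have := CA v (delta_mx i 0); rewrite -[LHS]addr0 -(AA2 (B *m v) (delta_mx i 0)).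
rewrite addrACA -mulmxDl -mulmxDr -/(g v) gv0 mul0mx mulmx0 addr0.
move/matrixP/(_ 0 0); rewrite !mxE eqxx mulr1n (bigD1 i) //= big1 => [|j /negPf ji].
  by rewrite !mxE !eqxx mul1r addr0.
by rewrite !mxE ji mul0r.
Qed.

(** * Reflections *)

Lemma mulmx_ext (R : pzRingType) m n (A A' : 'M[R]_(m, n)) :
  (forall v : 'cV_n, A *m v = A' *m v) -> A = A'.
Proof.
by move=> eqA; apply/matrixP=> i j; have /colP/(_ i) := eqA (delta_mx j 0);
  rewrite -!colE !mxE.
Qed.

Lemma mulr_rinv_inj (A : pzRingType) (x y a b : A) :
  x * y = 1 -> a * x = b * x -> a = b.
Proof.
by move=> xy1 /(congr1 (fun z => z * y)); rewrite /= -!mulrA xy1 !mulr1.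
Qed.

(** The inductive step of [vec_prod_twist]: each further factor [u] contributes one sign. *)
Lemma anticomm_sign_step (A : pzRingType) (a u w x v : A) k :
    a * u = - (u * w) -> w * x = (-1) ^+ k * (x * v) ->
  a * (u * x) = (-1) ^+ k.+1 * (u * x * v).
Proof.
move=> au wx; rewrite mulrA au mulNr -(mulrA u w) wx exprS mulN1r mulNr;
  congr (- _).
by rewrite (mulrA u) (commr_sign u) -!mulrA.
Qed.

Lemma conj_involution_exp (A : pzRingType) (x y : A) k :
  y * y = 1 -> (y * x * y) ^+ k = y * x ^+ k * y.
Proof.
move=> y2; elim: k => [|k IH]; first by rewrite mulr1 y2.
by rewrite exprS IH exprS !mulrA -(mulrA _ y y) y2 mulr1.
Qed.

Section QuadraticForms.
Variables (K : fieldType) (n : nat) (B : 'M[K]_n).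
Hypothesis B_sym : B^T = B.
Implicit Types (u v : 'cV[K]_n).

Definition bform u v : K := (u^T *m B *m v) 0 0.

Lemma bformC u v : bform u v = bform v u.
Proof. by rewrite /bform -[in LHS](trmxK (_ *m v)) [LHS]mxE !trmx_mul trmxK B_sym
  mulmxA. Qed.

Lemma bformDr u v x : bform u (v + x) = bform u v + bform u x.
Proof. by rewrite /bform mulmxDr mxE. Qed.

Lemma bformZr a u v : bform u (a *: v) = a * bform u v.
Proof. by rewrite /bform -scalemxAr mxE. Qed.

Lemma qformD u v : qform B (u + v) = qform B u + qform B v + 2 * bform u v.
Proof.
rewrite /qform -!/(bform _ _) bformDr (bformC _ u) (bformC _ v) !bformDr (bformC v
  u).
by rewrite mulr_natl mulr2n -!addrA; congr (_ + _);
  rewrite addrCA addrA addrC addrA.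
Qed.

Lemma qformZ a u : qform B (a *: u) = a ^+ 2 * qform B u.
Proof. by rewrite /qform -!/(bform _ _) bformZr bformC bformZr mulrA. Qed.

Lemma reflectionE u v :
  reflection B u *m v = v - (2 / qform B u * bform u v) *: u.
Proof.
rewrite /reflection mulmxBl mul1mx -scalemxAl -!mulmxA.
by rewrite [X in u *m X]mx11_scalar mul_mx_scalar scalerA mulmxA.
Qed.

Lemma qform_reflection u v :
  qform B u != 0 -> qform B (reflection B u *m v) = qform B v.
Proof.
move=> Qu; rewrite reflectionE -scaleNr qformD qformZ bformZr (bformC v).
by move: (bform u v) => b; field.
Qed.

Lemma reflection_sqr u : qform B u != 0 -> reflection B u * reflection B u = 1.
Proof.
move=> Qu; apply: mulmx_ext => v; rewrite mul1mx -mulmxA !reflectionE.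
rewrite bformDr -scaleNr bformZr -/(qform B u) scaleNr -addrA -scaleNr -scaleNr
  -scalerDl.
rewrite [X in X *: _](_ : _ = 0) ?scale0r ?addr0 // /bform -/(qform B u).
by field.
Qed.

Lemma reflection_orthogonal u : qform B u != 0 -> orthogonal_mx B (reflection B u).
Proof.
move=> Qu; split=> [|v]; last exact: qform_reflection.
by have [] := mulmx1_unit (reflection_sqr Qu).
Qed.

Lemma reflectionZ a u : a != 0 -> reflection B (a *: u) = reflection B u.
Proof.
move=> a0; apply: mulmx_ext => v; rewrite !reflectionE qformZ.
rewrite (bformC (a *: u)) bformZr (bformC v) scalerA; congr (_ - _ *: _).
by rewrite invfM; move: (qform B u)^-1 (bform u v) => q b; field.
Qed.

End QuadraticForms.

(** * Products of vectors and the covering of O(V) *)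

Section CliffordProducts.
Variables (K : fieldType) (n : nat) (B : 'M[K]_n).
Implicit Types (u v : 'cV[K]_n) (us ws : seq 'cV[K]_n) (e : K).

Local Notation scal := (clifford_scal B).
Local Notation vec := (clifford_vec B).

Lemma clifford_vec_inj : injective vec.
Proof.
have [d [rho [w [_ _ rho0]]]] := clifford_fock B.
move=> u v /eqP; rewrite -subr_eq0 -raddfB => /eqP uv0.
by apply/eqP; rewrite -subr_eq0; apply/eqP/rho0; rewrite uv0 raddf0.
Qed.

Lemma clifford_scal_eq0 c : (scal c == 0) = (c == 0).
Proof.
have [d [rho _]] := clifford_fock B.
apply/eqP/eqP=> [c0|->]; last exact: raddf0.
apply/eqP/negPn/negP=> cN0; have := congr1 (fun x => rho (scal c^-1 * x)) c0.
rewrite -rmorphM mulVf // !rmorph1 mulr0 raddf0 => /eqP.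
by rewrite oner_eq0.
Qed.

Lemma clifford_oner_neq0 : (1 : clifford B) != 0.
Proof. by rewrite -(rmorph1 scal) clifford_scal_eq0 oner_eq0. Qed.

Lemma clifford_anticomm u v :
  B^T = B -> vec u * vec v + vec v * vec u = scal (2 * bform B u v).
Proof.
move=> B_sym; have := clifford_vec_sqrE B (u + v).
rewrite qformD // 2!raddfD /= mulrDl !mulrDr !clifford_vec_sqrE raddfD /=.
set a := scal _; set b := scal (qform B v); set c := scal _;
  move: (vec u * _) (vec v * _) => x y.
by rewrite [y + b]addrC addrACA => /addrI.
Qed.

Definition vec_prod us : clifford B := \prod_(u <- us) vec u.
Definition refl_prod us : 'M[K]_n := \prod_(u <- us) reflection B u.
Definition all_norm e us := all (fun u => qform B u == e) us.
(** If Q(u) = e and e^2 = 1, then u has inverse e u in C(V); these are the factors of the inverse of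
    the product over [us]. *)
Definition inv_seq e us := [seq e *: u | u <- rev us].

Lemma vec_prod_cat us ws : vec_prod (us ++ ws) = vec_prod us * vec_prod ws.
Proof. exact: big_cat. Qed.

Lemma refl_prod_cat us ws : refl_prod (us ++ ws) = refl_prod us * refl_prod ws.
Proof. exact: big_cat. Qed.

Lemma all_norm_cat e us ws :
  all_norm e (us ++ ws) = all_norm e us && all_norm e ws.
Proof. exact: all_cat. Qed.

Lemma vec_prod_inv_seq e us :
  vec_prod (inv_seq e us) = scal (e ^+ size us) * vec_prod (rev us).
Proof.
rewrite /vec_prod /inv_seq -(size_rev us) big_map.
elim: (rev us) => [|u ws IH]; first by rewrite !big_nil rmorph1 mulr1.
by rewrite !big_cons IH clifford_vecZ exprS clifford_scalMM.
Qed.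

Hypothesis B_sym : B^T = B.
Variable e : K.
Hypothesis e_sqr : e * e = 1.

Let e_neq0 : e != 0.
Proof. by apply: contra_eqN e_sqr => /eqP->; rewrite mul0r eq_sym oner_eq0. Qed.

(** For one factor u with reflection R_u, using u^2 = Q(u): R_u(w) u = w u - 2 b(u, w) = w u - (u w
    + w u) = - u w. Thus conjugation by a product of vectors acts on V as the product of the
    reflections, up to the parity of the number of factors. *)
Lemma vec_prod_twist us v : all_norm e us ->
  vec (refl_prod us *m v) * vec_prod us
  = (-1) ^+ size us * (vec_prod us * vec v).
Proof.
rewrite /refl_prod /vec_prod.
elim: us => [|u us IH] /=; first by rewrite !big_nil mul1mx mulr1 expr0 !mul1r.
case/andP=> /eqP Qu /IH{}IH; rewrite !big_cons -mulmxE -mulmxA.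
set w := _ *m v in IH *; set X := \prod_(_ <- us) vec _ in IH *.
have twist : vec (reflection B u *m w) * vec u = - (vec u * vec w).
  rewrite reflectionE raddfB /= clifford_vecZ mulrBl -(mulrA _ (vec u))
    clifford_vec_sqrE.
  have Qu0 : qform B u != 0 by rewrite Qu.
  rewrite -rmorphM (_ : _ * qform B u = 2 * bform B u w); last by field.
  rewrite /= -clifford_anticomm // opprD.
  by rewrite [- _ - _]addrC addrA subrr add0r.
exact: anticomm_sign_step IH.
Qed.

Lemma all_norm_inv us : all_norm e us -> all_norm e (inv_seq e us).
Proof.
rewrite /all_norm /inv_seq all_map all_rev; apply: sub_all => u /= /eqP Qu.
by rewrite qformZ // Qu expr2 e_sqr mul1r.
Qed.

Lemma vec_prod_inv us : all_norm e us ->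
  vec_prod us * vec_prod (inv_seq e us) = 1 /\
  vec_prod (inv_seq e us) * vec_prod us = 1.
Proof.
rewrite /vec_prod /inv_seq.
elim: us => [|u us IH] /=; first by rewrite !big_nil mulr1.
case/andP=> /eqP Qu /IH[{}IH1 {}IH2].
rewrite rev_cons map_rcons !big_rcons !big_cons /= clifford_vecZ.
set X := \prod_(_ <- us) _ in IH1 IH2 *; set Y := \prod_(_ <- _) _ in IH1 IH2 *.
split.
  rewrite mulrA -(mulrA _ X) IH1 mulr1 clifford_scalC mulrA clifford_vec_sqrE.
  by rewrite -rmorphM Qu e_sqr rmorph1.
by rewrite -mulrA (mulrA _ _ X) -(mulrA (scal e)) clifford_vec_sqrE -rmorphM Qu
  e_sqr rmorph1 mul1r.
Qed.

Lemma refl_prod_inv us : all_norm e us ->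
  refl_prod us * refl_prod (inv_seq e us) = 1 /\
  refl_prod (inv_seq e us) * refl_prod us = 1.
Proof.
move=> Qus; suff E : refl_prod us * refl_prod (inv_seq e us) = 1.
  by split=> //; exact: mulmx1C.
move: Qus; rewrite /refl_prod /inv_seq.
elim: us => [|u us IH] /=; first by rewrite !big_nil mulr1.
case/andP=> /eqP Qu /IH{}IH; rewrite rev_cons map_rcons big_rcons big_cons /=.
rewrite mulrA -(mulrA _ (\prod_(_ <- us) _)) IH mulr1 reflectionZ //.
by apply: reflection_sqr; rewrite ?Qu.
Qed.

Hypothesis char_neq2 : (2 : K) != 0.

(* The grading of the Clifford algebra, read off in the Fock representation,
   recovers the parity of the number of factors. *)
Lemma vec_prod_parity us ws : all_norm e us ->
  vec_prod us = vec_prod ws -> odd (size us) = odd (size ws).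
Proof.
have [d [rho [w [ww w_anti _]]]] := clifford_fock B.
have w_twist vs :
    w * rho (vec_prod vs) = (-1) ^+ size vs * (rho (vec_prod vs) * w).
  rewrite /vec_prod; elim: vs => [|v vs IH]; first by rewrite big_nil rmorph1
    !mul1r mulr1.
  rewrite big_cons rmorphM mulrA w_anti mulNr -(mulrA _ w) IH exprS mulN1r mulNr.
  by congr (- _); rewrite mulrA (commr_sign (rho (vec v))) -!mulrA.
move=> Qus E; have := w_twist us; rewrite {1}E w_twist -E.
rewrite -signr_odd -[in RHS]signr_odd.
have [V1 _] := vec_prod_inv Qus.
have Uinv : rho (vec_prod us) * w * (w * rho (vec_prod (inv_seq e us))) = 1.
  by rewrite -mulrA (mulrA w w) ww mul1r -rmorphM V1 rmorph1.
move=> /(congr1 (fun x => x * (w * rho (vec_prod (inv_seq e us))))).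
rewrite -!(mulrA _ (_ * w)) Uinv !mulr1.
have neqN1 : (-1 : 'M[K]_d.+1) <> 1.
  move=> /eqP; rewrite eq_sym -subr_eq0 opprK -(rmorphD scalar_mx) => /eqP /(congr1
    (fun A : 'M_d.+1 => A 0 0)).
  by rewrite !mxE eqxx mulr1n; apply/eqP.
by case: odd; case: odd; rewrite ?expr0 ?expr1 // => /esym.
Qed.

(** This makes the covering map well defined. Both products of reflections are read off by
    conjugating vectors with the same element; the signs agree by [vec_prod_parity], and V embeds in
    C(V). *)
Lemma refl_prod_unique us ws : all_norm e us -> all_norm e ws ->
  vec_prod us = vec_prod ws -> refl_prod us = refl_prod ws.
Proof.
move=> Qus Qws E; apply: mulmx_ext => v; apply: clifford_vec_inj.
apply: (mulr_rinv_inj (vec_prod_inv Qws).1).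
rewrite (vec_prod_twist _ Qws) -{1}E (vec_prod_twist _ Qus) E.
by rewrite -signr_odd (vec_prod_parity Qus E) signr_odd.
Qed.

Lemma pin_vec_prod us : all_norm e us -> pin e (vec_prod us).
Proof.
rewrite /vec_prod; elim: us => [|u us IH] /=; first by rewrite big_nil => _;
  apply: unit_subgroup1.
case/andP=> /eqP Qu /IH{}IH; rewrite big_cons; apply: unit_subgroupM => //.
by apply: unit_subgroup_gen; exists u.
Qed.

(** Inverses need no letters of their own, since [inv_seq] again consists of vectors with Q = e. *)
Lemma pinP x : pin e x -> exists2 us, all_norm e us & x = vec_prod us.
Proof.
elim=> [{}x [u Qu ->]||{}x y _ [us Qus ->] _ [ws Qws ->]|{}x y _ [us Qus ->] _ yx].
- by exists [:: u]; rewrite /vec_prod /= ?Qu ?eqxx ?big_seq1.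
- by exists [::]; rewrite /vec_prod ?big_nil.
- by exists (us ++ ws); rewrite ?all_norm_cat ?Qus ?vec_prod_cat.
exists (inv_seq e us); first exact: all_norm_inv.
by rewrite -[LHS]mulr1 -(vec_prod_inv Qus).1 mulrA yx mul1r.
Qed.

Lemma pin_coveringE p us : pin_covering e p -> all_norm e us ->
  p (vec_prod us) = refl_prod us.
Proof.
move=> [p_orth pM p_refl]; rewrite /refl_prod /vec_prod.
elim: us => [_|u us IH /= /andP[/eqP Qu Qus]]; rewrite ?big_nil ?big_cons.
  (* [p 1] is idempotent and invertible, hence the identity. *)
  have pin1 : pin e (1 : clifford B) by apply: unit_subgroup1.
  have [p1_unit _] := p_orth _ pin1.
  have := congr1 (mulmx (invmx (p 1))) (pM _ _ pin1 pin1).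
  by rewrite mulr1 mulmxA mulVmx // mul1mx.
rewrite pM ?p_refl ?IH //; first by apply: unit_subgroup_gen; exists u.
exact: pin_vec_prod.
Qed.

Lemma refl_prod_orthogonal us : all_norm e us -> orthogonal_mx B (refl_prod us).
Proof.
rewrite /refl_prod; elim: us => [_|u us IH /= /andP[/eqP Qu /IH[IHu IHQ]]].
  by rewrite big_nil; split=> [|v]; [exact: unitmx1|rewrite mul1mx].
have [|Ru RQ] := @reflection_orthogonal _ _ _ B_sym u; first by rewrite Qu.
rewrite big_cons; split=> [|v]; first by rewrite unitmx_mul Ru.
by rewrite -mulmxE -mulmxA RQ.
Qed.

Lemma pin_covering_exists : exists p : clifford B -> 'M[K]_n,
  pin_covering e p /\ forall us, all_norm e us -> p (vec_prod us) = refl_prod us.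
Proof.
have /choice[p pE] (x : clifford B) : exists g : 'M[K]_n,
    forall us, all_norm e us -> x = vec_prod us -> g = refl_prod us.
  have [[ws [Qws ->]]|noW] := pselect (exists ws, all_norm e ws /\ x = vec_prod ws).
    by exists (refl_prod ws) => us Qus E; apply: refl_prod_unique.
  (* The value 0 is arbitrary: such an [x] lies outside Pin. *)
  by exists 0 => us Qus E; case: noW; exists us.
have {}pE us : all_norm e us -> p (vec_prod us) = refl_prod us.
  by move=> Qus; apply: pE.
exists p; split=> //; split=> [x|x y|u Qu].
- by case/pinP=> us Qus ->; rewrite pE //; apply: refl_prod_orthogonal.
- case/pinP=> us Qus -> /pinP[ws Qws ->].
  by rewrite -vec_prod_cat !pE ?all_norm_cat ?Qus // refl_prod_cat.
have := pE [:: u]; rewrite /vec_prod /refl_prod !big_seq1 => -> //=.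
by rewrite Qu eqxx.
Qed.

End CliffordProducts.

(** * The kernel of the covering *)

Section OrthonormalWords.
Variables (K : fieldType) (n : nat) (B : 'M[K]_n).
Hypotheses (B_sym : B^T = B) (char_neq2 : (2 : K) != 0).
Variable P : 'M[K]_n.
Hypothesis P_orthonormal : P^T *m B *m P = 1%:M.
Implicit Types (w : seq 'I_n) (l : seq (K * seq 'I_n)).

Local Notation scal := (clifford_scal B).
Local Notation vec := (clifford_vec B).
Local Notation gen i := (vec (col i P)).

Definition word_prod w : clifford B := \prod_(i <- w) gen i.

Lemma bform_col i j : bform B (col i P) (col j P) = (i == j)%:R.
Proof.
have /matrixP/(_ i j) := P_orthonormal; rewrite [RHS]mxE mulrb => <-.
by rewrite /bform !colE trmx_mul trmx_delta -!mulmxA -rowE !mulmxA -colE !mxE.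
Qed.

Lemma gen_sqr i : gen i * gen i = 1.
Proof. by rewrite clifford_vec_sqrE -[qform _ _]/(bform B _ _) bform_col eqxx
  rmorph1. Qed.

Lemma gen_anticomm i j : i != j -> gen i * gen j = - (gen j * gen i).
Proof.
move=> ij; apply/eqP; rewrite -addr_eq0 clifford_anticomm // bform_col.
by rewrite (negPf ij) mulr0 raddf0.
Qed.

(** A generator commutes with itself and anticommutes with the others, so the sign counts the
    letters of [w] other than [i]. The sum in the exponent has the parity of that difference and
    avoids subtraction. *)
Lemma gen_conj i w :
  gen i * word_prod w * gen i = (-1) ^+ (size w + count_mem i w) * word_prod w.
Proof.
rewrite /word_prod; elim: w => [|j w IH]; first by rewrite big_nil mulr1 mul1r
  gen_sqr.
rewrite big_cons [size _]/= [count_mem _ _]/=; set X := \prod_(_ <- w) _ in IH *.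
case: (eqVneq j i) IH => [<-|ij] IH.
  rewrite -[nat_of_bool true]/1%N addnA addn1 addSn !exprS !mulN1r opprK mulrA
    gen_sqr mul1r.
  move: IH => /(congr1 (fun x => gen j * x)); rewrite /= !mulrA gen_sqr mul1r => ->.
  by rewrite (commr_sign (gen j)).
rewrite -[nat_of_bool false]/0%N add0n addSn exprS mulN1r mulNr (mulrA (gen i))
  gen_anticomm 1?eq_sym //.
by rewrite !mulNr -(mulrA _ (gen i)) -(mulrA _ (_ * X)) IH mulrA (commr_sign (gen
  j)) -mulrA.
Qed.

Lemma word_prod_rev w : word_prod w * word_prod (rev w) = 1.
Proof.
rewrite /word_prod; elim: w => [|i w IH]; first by rewrite !big_nil mulr1.
by rewrite rev_cons big_rcons big_cons /= mulrA -(mulrA (gen i)) IH mulr1 gen_sqr.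
Qed.

Definition even_word w := [forall i, ~~ odd (count_mem i w)].

(** Induction on the length: the first letter occurs again, [gen_conj] cancels the two occurrences
    up to a sign, and the shorter word left is still even. *)
Lemma even_word_prod w : even_word w ->
  ~~ odd (size w) /\ (word_prod w = 1 \/ word_prod w = -1).
Proof.
have [k] := ubnP (size w); elim: k w => // k IH [|i w] /= size_w ev_w.
  by split=> //; left; rewrite /word_prod big_nil.
have i_w : i \in w.
  move/forallP/(_ i): ev_w; rewrite /= eqxx -has_pred1 has_count.
  by case: count.
case/splitPr: i_w size_w ev_w => w1 w2 size_w ev_w.
have [||ev12 prod12] := IH (w1 ++ w2).
- by move: size_w; rewrite !size_cat /= addnS !ltnS; apply: leq_trans.
- apply/forallP=> j; move/forallP/(_ j): ev_w; rewrite /= !count_cat /=.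
  by rewrite !oddD; do 3!case: odd => //; case: (i == j).
split; first by move: ev12; rewrite !size_cat /= addnS /= negbK.
have -> : word_prod (i :: w1 ++ i :: w2) =
    gen i * word_prod w1 * gen i * word_prod w2.
  by rewrite /word_prod big_cons big_cat big_cons /= !mulrA.
rewrite gen_conj -mulrA -signr_odd.
have -> : word_prod w1 * word_prod w2 = word_prod (w1 ++ w2).
  by rewrite /word_prod big_cat.
by case: odd; case: prod12 => ->; rewrite ?expr0 ?expr1 ?mul1r ?mulN1r ?opprK; auto.
Qed.

Lemma even_word_prod_rev w : even_word w -> word_prod (rev w) = word_prod w.
Proof.
move=> /even_word_prod[_ w1]; have := word_prod_rev w.
by case: w1 => ->; rewrite ?mul1r // mulN1r => <-; rewrite opprK.
Qed.

Lemma even_word_rev w : even_word (rev w) = even_word w.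
Proof. by apply: eq_forallb => i; rewrite count_rev. Qed.

Definition expansion l : clifford B := \sum_(a <- l) scal a.1 * word_prod a.2.

(* Conjugation by a generator multiplies a word of odd multiplicity in this
   generator by [- (-1) ^+ N], so an invariant element has no such words. *)
Lemma expansion_even N z l : all (fun a => size a.2 == N) l ->
    (forall i, gen i * z * gen i = (-1) ^+ N * z) -> z = expansion l ->
  z = expansion [seq a <- l | even_word a.2].
Proof.
move=> size_l z_inv zE.
(* The letters are treated one at a time: [ev s] tests the multiplicities of the letters in [s]
   only. *)
pose ev (s : seq 'I_n) (a : K * seq 'I_n) := all (fun i => ~~ odd (count_mem i
  a.2)) s.
have -> : [seq a <- l | even_word a.2] = [seq a <- l | ev (enum 'I_n) a].
  apply: eq_filter => a; apply/forallP/allP=> [ev_a i _|ev_a i]; first exact: ev_a.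
  by apply: (ev_a i); rewrite mem_enum.
elim: (enum _) => [|i s IH]; first by rewrite filter_predT.
have -> : [seq a <- l | ev (i :: s) a]
    = [seq a <- [seq a <- l | ev s a] | ~~ odd (count_mem i a.2)].
  by rewrite -filter_predI.
have : all (fun a => size a.2 == N) [seq a <- l | ev s a].
  by apply/allP=> a; rewrite mem_filter => /andP[_ /(allP size_l)].
move: [seq a <- l | ev s a] IH => {l ev size_l zE} l zE size_l.
have conj_term (a : K * seq 'I_n) : a \in l ->
    gen i * (scal a.1 * word_prod a.2) * gen i =
    (-1) ^+ N * ((-1) ^+ odd (count_mem i a.2) * (scal a.1 * word_prod a.2)).
  move=> /(allP size_l)/eqP <-; rewrite signr_odd [RHS]mulrA -exprD.
  rewrite (mulrA (gen i)) -clifford_scalC -!(mulrA (scal _)) gen_conj.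
  by rewrite !mulrA clifford_scalC.
pose odd_part := \sum_(a <- l | odd (count_mem i a.2)) scal a.1 * word_prod a.2.
have zS : z = odd_part + expansion [seq a <- l | ~~ odd (count_mem i a.2)].
  by rewrite [LHS]zE /expansion big_filter (bigID (fun a => odd (count_mem i a.2))).
have := z_inv i; rewrite {1}zE /expansion mulr_sumr mulr_suml big_seq.
rewrite (eq_bigr _ conj_term) -mulr_sumr -big_seq => /(congr1 (fun x => (-1) ^+ N *
  x)).
rewrite /= !signrMK.
rewrite -/(expansion _) (bigID (fun a => odd (count_mem i a.2))) /= => z_split.
suff odd0 : odd_part = 0 by rewrite [LHS]zS odd0 add0r.
(* Conjugation by [gen i], corrected by the sign [(-1) ^+ N], fixes [z] and the even part but
   negates the odd part. Comparing [zS] with [z_split] gives [odd_part = - odd_part]. *)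
have : scal 2 * odd_part = 0.
  rewrite rmorph_nat mulr_natl mulr2n; apply/eqP; rewrite addr_eq0; apply/eqP.
  apply: (@addIr _ (expansion [seq a <- l | ~~ odd (count_mem i a.2)])).
  rewrite -zS -z_split /expansion big_filter -sumrN; congr (_ + _).
    by apply: eq_bigr => a ->; rewrite mulN1r.
  by apply: eq_bigr => a /negPf->; rewrite mul1r.
move/(congr1 (fun x => scal 2^-1 * x)).
by rewrite /= mulrA -rmorphM mulVf // rmorph1 mul1r mulr0.
Qed.

Lemma expansion_rev l : all (even_word \o snd) l ->
  expansion [seq (a.1, rev a.2) | a <- l] = expansion l.
Proof.
move=> ev_l; rewrite /expansion big_map !big_seq; apply: eq_bigr => a a_l /=.
by rewrite even_word_prod_rev //; apply: (allP ev_l).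
Qed.

Lemma expansion_scal l : all (even_word \o snd) l ->
  exists c, expansion l = scal c.
Proof.
rewrite /expansion; elim: l => [_|a l IH /= /andP[/even_word_prod[_ prod_a]
  /IH[c]]].
  by exists 0; rewrite big_nil raddf0.
rewrite big_cons => ->; case: prod_a => ->.
  by exists (a.1 + c); rewrite raddfD /= mulr1.
by exists (- a.1 + c); rewrite raddfD raddfN /= mulrN1.
Qed.

(** Each vector is expanded in the orthonormal basis. Recording the reversed product with the same
    coefficients gives access to the reversal of C(V) on these products without constructing that
    antiautomorphism. *)
Lemma vec_prod_expansion us : exists l,
  [/\ all (fun a => size a.2 == size us) l, vec_prod B us = expansion l
    & vec_prod B (rev us) = expansion [seq (a.1, rev a.2) | a <- l]].
Proof.
have P_unit : P \in unitmx by case: (mulmx1_unit P_orthonormal).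
rewrite /vec_prod /expansion.
elim: us => [|u us [l [size_l uE ruE]]].
  exists [:: (1, [::])]; rewrite !big_nil !big_seq1 /= /word_prod !big_nil.
  by rewrite rmorph1 mulr1.
pose c i := (invmx P *m u) i 0.
have vec_u : vec u = \sum_i scal (c i) * gen i.
  have uE' : u = \sum_i c i *: col i P.
    rewrite -[u in LHS](mulKVmx P_unit); apply/colP=> k; rewrite summxE mxE.
    by apply: eq_bigr => i _; rewrite [RHS]mxE [X in _ = _ * X]mxE mulrC.
  by rewrite {1}uE' raddf_sum; apply: eq_bigr => i _; rewrite -clifford_vecZ.
exists [seq (c i * a.1, i :: a.2) | i <- enum 'I_n, a <- l]; split.
- by apply/allP=> b /allpairsP[[i a] /= [_ /(allP size_l)/= size_a ->]].
- rewrite big_cons uE vec_u mulr_suml big_allpairs_dep /= big_enum /=.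
  apply: eq_bigr => i _; rewrite mulr_sumr; apply: eq_bigr => a _ /=.
  by rewrite /word_prod big_cons clifford_scalMM.
rewrite rev_cons big_rcons /= ruE vec_u mulr_sumr !big_map big_allpairs_dep /=
  big_enum /=.
apply: eq_bigr => i _; rewrite mulr_suml; apply: eq_bigr => a _ /=.
rewrite /word_prod rev_cons big_rcons /= [LHS]mulrA -(mulrA (scal _)).
by rewrite -clifford_scalC !mulrA -!rmorphM [a.1 * _]mulrC.
Qed.

Variable e : K.
Hypothesis e_sqr : e * e = 1.

(* A product with trivial covering image is central or anticentral, hence a
   scalar equal to its own reversal. *)
Lemma vec_prod_kernel us : all_norm B e us -> refl_prod B us = 1 ->
  vec_prod B us = 1 \/ vec_prod B us = -1.
Proof.
move=> Qus R1; have [l [size_l uE ruE]] := vec_prod_expansion us.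
have inv_us ws : size ws = size us -> all_norm B e ws -> refl_prod B ws = 1 ->
    forall i, gen i * vec_prod B ws * gen i = (-1) ^+ size us * vec_prod B ws.
  move=> size_ws Qws Rws i; have := vec_prod_twist B_sym e_sqr (col i P) Qws.
  by rewrite Rws mul1mx size_ws => ->; rewrite -!mulrA gen_sqr mulr1.
have Qrev : all_norm B e (rev us) by rewrite /all_norm all_rev.
have Rrev : refl_prod B (rev us) = 1.
  have := (refl_prod_inv B_sym e_sqr Qus).1; rewrite R1 mul1r => <-.
  rewrite /refl_prod /inv_seq big_map; apply: eq_bigr => u _.
  rewrite reflectionZ //; apply: contra_eqN e_sqr => /eqP->.
  by rewrite mul0r eq_sym oner_eq0.
pose l' := [seq a <- l | even_word a.2].
have ev_l' : all (even_word \o snd) l' by apply: filter_all.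
have {}uE : vec_prod B us = expansion l'.
  exact: (expansion_even size_l (inv_us us erefl Qus R1)).
(* Only even words survive in either expansion, and reversing an even word does not change its
   product. *)
have {}ruE : vec_prod B (rev us) = vec_prod B us.
  rewrite uE -expansion_rev // [LHS](expansion_even (N := size us) _ _ ruE).
  - rewrite filter_map; congr (expansion (map _ _)); apply: eq_filter => a /=.
    exact: even_word_rev.
  - by rewrite all_map; apply: sub_all size_l => a /=; rewrite size_rev.
  exact: inv_us (size_rev us) Qrev Rrev.
have [c cE] := expansion_scal ev_l'.
(* Even words have even length. In odd length none survives, so the product would be 0 although it
   is invertible. *)
have [N_odd|N_even] := boolP (odd (size us)).
  suff l'_nil : l' = [::].
    have /eqP := (vec_prod_inv e_sqr Qus).1.
    by rewrite uE l'_nil /expansion big_nil mul0r eq_sym (negPf (clifford_oner_neq0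
      B)).
  apply/eqP; rewrite -size_eq0 size_filter -leqn0 leqNgt -has_count.
  apply/hasPn=> a /(allP size_l)/eqP size_a; apply/negP=> /even_word_prod[].
  by rewrite size_a N_odd.
(* In even length e^N = 1, so the inverse is the reversed product, which is the product itself;
   hence c^2 = 1. *)
have := (vec_prod_inv e_sqr Qus).1.
rewrite vec_prod_inv_seq ruE uE cE.
have -> : e ^+ size us = 1.
  by rewrite -(odd_double_half (size us)) (negPf N_even) add0n -mul2n exprM expr2
    e_sqr expr1n.
rewrite rmorph1 mul1r -rmorphM => /eqP; rewrite -subr_eq0 -(rmorph1 scal) -raddfB.
rewrite clifford_scal_eq0 subr_eq0 -expr2 sqrf_eq1 => /orP[]/eqP->.
  by left; rewrite rmorph1.
by right; rewrite rmorphN1.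
Qed.

End OrthonormalWords.

(** * Lifts of orthogonal involutions *)

Section CoordinateReflections.
Variables (K : fieldType) (n : nat) (B P : 'M[K]_n).
Hypotheses (B_sym : B^T = B) (P_orthonormal : P^T *m B *m P = 1%:M).
Variable c : K.
Hypothesis c_neq0 : c != 0.
Implicit Type w : seq 'I_n.

(** With [c] a square root of [e], these vectors have Q = e, which treats both Pin groups at
    once. *)
Definition scaled_cols w : seq 'cV[K]_n := [seq c *: col i P | i <- w].

Lemma all_norm_scaled_cols w : all_norm B (c * c) (scaled_cols w).
Proof.
rewrite /all_norm all_map; apply/allP=> i _ /=.
by rewrite qformZ // -[qform _ _]/(bform B _ _) bform_col // eqxx mulr1.
Qed.

Lemma vec_prod_scaled_cols w :
  vec_prod B (scaled_cols w) = clifford_scal B (c ^+ size w) * word_prod B P w.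
Proof.
rewrite /vec_prod /word_prod big_map.
elim: w => [|i w IH]; first by rewrite !big_nil rmorph1 mulr1.
by rewrite !big_cons IH clifford_vecZ exprS clifford_scalMM.
Qed.

(** Moving the first letter across the rest costs one sign per letter passed; the signs add up to
    the binomial coefficient by Pascal's rule. *)
Lemma word_prod_sqr w : uniq w ->
  word_prod B P w * word_prod B P w = (-1) ^+ 'C(size w, 2).
Proof.
elim: w => [_|i w IH /= /andP[i_w /IH{}IH]].
  by rewrite /word_prod big_nil mulr1.
have := gen_conj B_sym P_orthonormal i w; rewrite (count_memPn i_w) addn0 => conj_w.
rewrite [word_prod B P (_ :: _)]big_cons -/(word_prod B P w).
by rewrite mulrA conj_w -mulrA IH -exprD binS bin1 addnC.
Qed.

Lemma vec_prod_scaled_cols_sqr w : uniq w ->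
  vec_prod B (scaled_cols w) * vec_prod B (scaled_cols w) =
  (-1) ^+ 'C(size w, 2) * clifford_scal B ((c * c) ^+ size w).
Proof.
move=> uniq_w; rewrite vec_prod_scaled_cols mulrA -(mulrA (clifford_scal _ _)).
rewrite -clifford_scalC !mulrA -rmorphM -mulrA word_prod_sqr // exprMn.
exact: clifford_scalC.
Qed.

Lemma refl_prod_scaled_cols w j : uniq w ->
  refl_prod B (scaled_cols w) *m col j P = (-1) ^+ (j \in w) *: col j P.
Proof.
rewrite /refl_prod big_map.
elim: w => [_|i w IH /= /andP[i_w /IH{}IH]].
  by rewrite big_nil mul1mx in_nil scale1r.
rewrite big_cons -mulmxE -mulmxA IH in_cons reflectionZ // -scalemxAr.
rewrite reflectionE bform_col // -[qform _ _]/(bform B _ _) bform_col // eqxx divr1.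
have [->|ji] := eqVneq j i; last by rewrite /= mulr0 scale0r subr0.
rewrite (negPf i_w) expr0 expr1 scale1r mulr1 -scaleNr -{1}[col i P]scale1r
  -scalerDl.
by congr (_ *: _); rewrite -[2]/(1 + 1) opprD addrA subrr add0r.
Qed.

End CoordinateReflections.

Section Involutions.
Variables (K : numClosedFieldType) (n : nat) (B g : 'M[K]_n).
Hypothesis B_nondeg : nondeg_sym B.
Hypothesis g_orth : orthogonal_mx B g.
Hypothesis g_sqr : g *m g = 1%:M.

Let B_sym : B^T = B. Proof. by case: B_nondeg. Qed.

Lemma qform_eq0 (A : 'M[K]_n) : A^T = A -> (forall v, qform A v = 0) -> A = 0.
Proof.
move=> A_sym A0; apply: mulmx_ext => v; apply/colP=> i.
have := qformD A_sym (delta_mx i 0) v; rewrite !A0 !addr0 add0r => /eqP.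
rewrite eq_sym mulf_eq0 pnatr_eq0 /= /bform mul0mx [RHS]mxE => /eqP <-.
by rewrite trmx_delta -rowE -row_mul [RHS]mxE.
Qed.

Lemma orthogonal_mxE : g^T *m B *m g = B.
Proof.
apply/eqP; rewrite -subr_eq0; apply/eqP/qform_eq0 => [|v].
  by rewrite raddfB /= !trmx_mul trmxK B_sym mulmxA.
have [_ /(_ v)] := g_orth.
rewrite /qform trmx_mul mulmxBr mulmxBl !mulmxA => gv.
by rewrite mxE [X in _ + X]mxE gv subrr.
Qed.

(* Completing [P]: [M] is the projection onto the orthogonal complement of the
   columns of [P]; it commutes with [g], and [v + g v] and [v - g v] cannot both
   be isotropic modulo these columns for all [v]. *)
Lemma eigenbasis_extend k (P : 'M[K]_(n, k)) (D : 'rV[K]_k) :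
    (k < n)%N -> P^T *m B *m P = 1%:M -> g *m P = P *m diag_mx D ->
  exists w a, [/\ P^T *m B *m w = 0, qform B w = 1, g *m w = a *: w & a * a = 1].
Proof.
(* An orthogonal involution is self-adjoint for [B]. *)
move=> k_n PBP gP; have gB : g^T *m B = B *m g.
  by rewrite -[in RHS]orthogonal_mxE -!mulmxA g_sqr mulmx1.
have [M ME] : exists M, M = 1%:M - P *m P^T *m B by eexists.
have PBM : P^T *m B *m M = 0.
  by rewrite ME mulmxBr mulmx1 !mulmxA PBP mul1mx subrr.
have PBg : P^T *m B *m g = diag_mx D *m P^T *m B.
  by rewrite -mulmxA -gB mulmxA -trmx_mul gP trmx_mul tr_diag_mx.
have gM : g *m M = M *m g.
  rewrite ME mulmxBr mulmxBl mulmx1 mul1mx; congr (_ - _).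
  by rewrite -!mulmxA (mulmxA _ B g) PBg !mulmxA gP.
have MT : M^T = 1%:M - B *m P *m P^T.
  by rewrite ME [LHS]linearB /= trmx1 !trmx_mul trmxK B_sym mulmxA.
have MBM : M^T *m B *m M = B *m M.
  by rewrite MT -mulmxA !mulmxBl mul1mx -!mulmxA (mulmxA P^T) PBM !mulmx0 subr0.
have [[v [a [a2 Qw]]]|no_w] :=
    pselect (exists v a, a * a = 1 /\ qform B (M *m (v + a *: (g *m v))) != 0).
  set w := M *m _ in Qw; pose q := sqrtC (qform B w).
  have q2 : q ^+ 2 = qform B w by apply: sqrtCK.
  exists (q^-1 *: w), a; split=> //.
  - by rewrite -scalemxAr /w mulmxA PBM mul0mx scaler0.
  - by rewrite qformZ // exprVn q2 mulVf.
  - rewrite -scalemxAr scalerA mulrC -scalerA; congr (_ *: _).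
    rewrite /w mulmxA gM -mulmxA [RHS]scalemxAr; congr (_ *m _).
    by rewrite mulmxDr -scalemxAr mulmxA g_sqr mul1mx scalerDr scalerA a2 scale1r
      addrC.
(* In the remaining case v + g v and v - g v are isotropic for the form of [B *m M], for every v.
   Their values add up to four times the value at v, so this form vanishes, and [M = 0] since [B] is
   invertible. *)
have QM v a : a * a = 1 -> qform (B *m M) (v + a *: (g *m v)) = 0.
  move=> a2; apply/eqP; rewrite -[_ == _]negbK; apply/negP=> Qv; apply: no_w.
  exists v, a; split=> //; move: Qv; rewrite -MBM /qform.
  by rewrite trmx_mul !mulmxA.
have BM_sym : (B *m M)^T = B *m M.
  by rewrite -MBM !trmx_mul trmxK B_sym mulmxA.
have /(congr1 (mulmx (invmx B))) : B *m M = 0.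
  apply: qform_eq0 => // v.
  have := QM v 1 (mulr1 1); have := QM v (- 1) (etrans (mulrNN 1 1) (mulr1 1)).
  have Qg : qform (B *m M) (g *m v) = qform (B *m M) v.
    rewrite /qform trmx_mul -!mulmxA; congr ((_ *m _) 0 0).
    by rewrite (mulmxA g^T) gB !mulmxA -(mulmxA B) gM -!mulmxA (mulmxA g) g_sqr
      mul1mx.
  rewrite !qformD // !bformZr !qformZ // Qg.
  move: (qform _ v) (bform _ _ _) => q b E1 E2.
  have /eqP : 4 * q = 0 by rewrite -[RHS](addr0 0) -[X in X + _]E1 -[X in _ + X]E2;
    ring.
  by rewrite mulf_eq0 pnatr_eq0 => /eqP.
rewrite mulKmx ?mulmx0; last by case: B_nondeg.
rewrite ME => /eqP; rewrite subr_eq0 => /eqP PPB1.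
(* The identity of rank n would factor through the k columns of [P], with k < n. *)
have := mxrankM_maxl P (P^T *m B); rewrite mulmxA -PPB1 mxrank1 leqNgt.
by rewrite (leq_ltn_trans (rank_leq_col P) k_n).
Qed.

(** [eigenbasis_extend] supplies the columns one by one, with eigenvalues 1 or -1 on the diagonal
    [D]; [w] lists the indices of eigenvalue -1. *)
Lemma involution_eigenbasis :
  exists (P : 'M[K]_n) (w : seq 'I_n), [/\ P^T *m B *m P = 1%:M, uniq w
    & forall j, g *m col j P = (-1) ^+ (j \in w) *: col j P].
Proof.
suff [P [D [PBP gP D2]]] : exists (P : 'M[K]_n) (D : 'rV[K]_n),
    [/\ P^T *m B *m P = 1%:M, g *m P = P *m diag_mx D & forall j, D 0 j * D 0 j =
      1].
  exists P, (enum [pred j | D 0 j == -1]); split=> [//||j]; first exact: enum_uniq.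
  rewrite mem_enum inE; have /matrixP/(_ _ j) := gP.
  rewrite !colE mulmxA gP => _; rewrite -mulmxA -!colE; apply/colP=> i.
  rewrite !mxE (bigD1 j) //= big1 ?addr0 => [|k /negPf kj]; last first.
    by rewrite !mxE kj mulr0n mulr0.
  rewrite !mxE eqxx mulr1n mulrC; congr (_ * _).
  have [->|DN1] := eqVneq; first by rewrite expr1.
  by have := D2 j => /eqP; rewrite -expr2 sqrf_eq1 (negPf DN1) orbF => /eqP.
suff ext k : (k <= n)%N -> exists (P : 'M[K]_(n, k)) (D : 'rV[K]_k),
    [/\ P^T *m B *m P = 1%:M, g *m P = P *m diag_mx D & forall j, D 0 j * D 0 j =
      1].
  exact: ext.
elim: k => [_|k IH k_n].
  by exists 0, 0; split=> [||[]//]; [apply/matrixP=> -[]|rewrite mulmx0 mul0mx].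
have [P [D [PBP gP D2]]] := IH (ltnW k_n).
have [w [a [PBw Qw gw a2]]] := eigenbasis_extend k_n PBP gP.
rewrite -addn1; exists (row_mx P w), (row_mx D (const_mx a)); split.
- rewrite tr_row_mx mul_col_mx mul_col_row PBP PBw.
  have -> : w^T *m B *m P = 0.
    by apply: trmx_inj; rewrite !trmx_mul trmxK B_sym mulmxA PBw trmx0.
  by rewrite [w^T *m _ *m _]mx11_scalar -/(qform B w) Qw -scalar_mx_block.
- rewrite mul_mx_row gP gw diag_mx_row mul_row_block !mulmx0 addr0 add0r.
  by rewrite diag_const_mx mul_mx_scalar.
by move=> j; rewrite -[j]splitK; case: (split j) => i /=;
  rewrite ?row_mxEl ?row_mxEr ?mxE.
Qed.

End Involutions.

(** [us] consists of the (-1)-eigenvectors of an orthonormal eigenbasis, rescaled by a square root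
    of [e]. The trace formula later identifies [size us] with t_pi. *)
Lemma involution_lift (K : numClosedFieldType) n (B g : 'M[K]_n) (e : K) :
    nondeg_sym B -> orthogonal_mx B g -> g *m g = 1%:M -> e * e = 1 ->
  exists us, [/\ all_norm B e us, refl_prod B us = g,
    vec_prod B us * vec_prod B us
      = (-1) ^+ 'C(size us, 2) * clifford_scal B (e ^+ size us),
    \tr g = n%:R - 2 * (size us)%:R & \det g = (-1) ^+ size us].
Proof.
move=> B_nondeg g_orth g2 e2; have B_sym : B^T = B by case: B_nondeg.
have [P [w [PBP uniq_w gP]]] := involution_eigenbasis B_nondeg g_orth g2.
pose c := sqrtC e; have cc : c * c = e by rewrite -expr2 sqrtCK.
have c0 : c != 0.
  by apply: contra_eqN e2 => /eqP c0; rewrite -cc c0 !mul0r eq_sym oner_eq0.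
have P_unit : P \in unitmx by case: (mulmx1_unit PBP).
pose d : 'rV[K]_n := \row_j (-1) ^+ (j \in w).
have gE : g = P *m diag_mx d *m invmx P.
  rewrite -[LHS](mulmxK P_unit); congr (_ *m _); apply/matrixP=> i j.
  have /colP/(_ i) := gP j; rewrite [in LHS]colE mulmxA -colE mxE => ->.
  rewrite !mxE (bigD1 j) //= big1 ?addr0 => [|k /negPf kj]; last first.
    by rewrite !mxE kj mulr0n mulr0.
  by rewrite !mxE eqxx mulr1n mulrC.
have card_w : #|[pred j | j \in w]| = size w by rewrite -(card_uniqP uniq_w);
  apply: eq_card.
exists (scaled_cols P c w); rewrite size_map; split.
- by rewrite -cc; apply: all_norm_scaled_cols.
- have eqP' : refl_prod B (scaled_cols P c w) *m P = g *m P.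
    apply/matrixP=> i j; have /colP/(_ i) := gP j.
    rewrite -(refl_prod_scaled_cols B_sym PBP c0 j uniq_w).
    by rewrite !colE !mulmxA -!colE !mxE.
  by rewrite -[LHS](mulmxK P_unit) eqP' mulmxK.
- by rewrite -cc; exact: vec_prod_scaled_cols_sqr.
- rewrite gE mxtrace_mulC mulmxA mulVmx // mul1mx mxtrace_diag.
  rewrite (bigID (mem w)) /= (eq_bigr (fun=> -1)) => [|j jw];
    last by rewrite mxE jw.
  rewrite [X in _ + X](eq_bigr (fun=> 1)) => [|j /negPf jw]; last by rewrite mxE jw.
  rewrite !sumr_const card_w.
  have -> : n%:R = (size w + #|[predC w]|)%:R :> K.
    by rewrite -(card_uniqP uniq_w) cardC card_ord.
  rewrite natrD mulr_natl mulr2n mulNrn opprD addrACA subrr add0r addrC.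
  by congr (_%:R - _); apply: eq_card.
rewrite gE !det_mulmx det_inv mulrAC mulrV ?mul1r -?unitmxE // det_diag.
rewrite (bigID (mem w)) /= (eq_bigr (fun=> -1)) => [|j jw]; last by rewrite mxE jw.
rewrite [X in _ * X]big1 ?mulr1 => [|j /negPf jw]; last by rewrite mxE jw.
by rewrite prodr_const card_w.
Qed.

(** * Dihedral groups *)

Section Dihedral.
Variables (m : nat) (gT : finGroupType) (G : {group gT}) (r s : gT).
Hypotheses (dihG : is_dihedral m G r s) (m_gt0 : (0 < m)%N).

Lemma dihedral_gens : r \in G /\ s \in G.
Proof.
have [GE _ _ _ _] := dihG.
by split; rewrite -[_ \in G]/(_ \in (G : {set gT})) GE mem_gen ?set21 ?set22.
Qed.

Lemma dihedral_reflection_sqr : ((s * r) * (s * r) = 1)%g.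
Proof.
have [_ _ s2 rs _] := dihG.
by rewrite -mulgA (mulgA r) rs -(mulgA s) mulVg mulg1; exact: s2.
Qed.

Lemma dihedral_cycles : G :=: (<[r]> * <[s]>)%g.
Proof.
have [GE rm s2 rs _] := dihG.
rewrite GE -[<<_>>%g]/([set r] <*> [set s])%g -joing_idl -joing_idr.
rewrite norm_joinEr // cycle_subG; apply/normP.
rewrite -cycleJ /conjg rs mulgA.
have -> : (s^-1 * s * r^-1 = r^-1)%g by rewrite mulVg mul1g.
exact: cycleV.
Qed.

Lemma dihedral_elt g : g \in G -> exists i j, (g = r ^+ i * s ^+ j)%g.
Proof.
rewrite -[_ \in G]/(_ \in (G : {set gT})) dihedral_cycles.
by case/mulsgP=> _ _ /cycleP[i ->] /cycleP[j ->] ->; exists i, j.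
Qed.

(** Since G is the product of the two cyclic groups and has order 2m, a count forces their orders to
    be exactly m and 2 and their intersection to be trivial. *)
Lemma dihedral_inj i j k l : (r ^+ i * s ^+ j = r ^+ k * s ^+ l)%g ->
  i = k %[mod m] /\ j = l %[mod 2].
Proof.
have [_ rm s2 _ oG] := dihG.
have r_le : (#[r]%g <= m)%N by rewrite dvdn_leq // order_dvdn rm.
have s_le : (#[s]%g <= 2)%N by rewrite dvdn_leq // order_dvdn s2.
have := mul_cardG <[r]>%G <[s]>%G; rewrite -dihedral_cycles oG -!orderE => cardE.
have cap_gt0 : (0 < #|<[r]>%g :&: <[s]>%g|)%N by apply: cardG_gt0.
have [r_eq s_eq cap1] :
    [/\ #[r]%g = m, #[s]%g = 2%N & #|<[r]>%g :&: <[s]>%g| = 1%N].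
  move: cardE r_le s_le cap_gt0; move: #|_| #[r]%g #[s]%g => c a b.
  rewrite -muln2 => abE a_le b_le c_gt0.
  have ab_le : (a * b <= m * 2)%N by apply: leq_mul.
  have c1 : c = 1%N.
    apply/eqP; rewrite eqn_leq c_gt0 andbT.
    by rewrite -(leq_pmul2l (_ : 0 < m * 2)%N) ?muln1 -?abE // muln_gt0 m_gt0.
  rewrite c1 muln1 in abE; split=> //; apply/eqP; rewrite eqn_leq ?a_le ?b_le /=.
    by rewrite -(leq_pmul2r (isT : 0 < 2)%N) -abE leq_mul2l b_le orbT.
  by rewrite -(leq_pmul2l m_gt0) -abE leq_mul2r a_le orbT.
have TI : <[r]>%g :&: <[s]>%g = 1%g by apply/eqP; rewrite trivg_card1 cap1.
move=> E; have E' : ((r ^+ k)^-1 * r ^+ i = s ^+ l * (s ^+ j)^-1)%g.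
  by apply: (mulgI (r ^+ k)%g); rewrite mulKVg mulgA -E mulgK.
have : ((r ^+ k)^-1 * r ^+ i)%g \in <[r]>%g :&: <[s]>%g.
  by rewrite inE {2}E' !groupM ?groupV ?mem_cycle.
rewrite TI => /set1P ri; split.
  apply/eqP; rewrite -r_eq -eq_expg_mod_order.
  by rewrite -[X in _ == X]mulg1 -ri mulKVg.
apply/eqP; rewrite -s_eq -eq_expg_mod_order eq_sym.
by rewrite -[X in X == _](mulgKV (s ^+ j)%g) -E' ri mul1g.
Qed.

(** The exponent [m.-1] replaces -1, so that the same rule makes sense for elements of a ring in
    [dihedral_extend]. *)
Lemma dihedral_commute j k :
  (s ^+ j * r ^+ k = r ^+ (k * m.-1 ^ j) * s ^+ j)%g.
Proof.
have [_ rm s2 rs _] := dihG.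
have sr : (s * r = r ^+ m.-1 * s)%g.
  have -> : (r ^+ m.-1 = r^-1)%g.
    by apply: (mulgI r); rewrite -expgS prednK // rm mulgV.
  have := dihedral_reflection_sqr; rewrite mulgA => /(canRL (mulgK _)).
  rewrite mul1g => /(congr1 (fun x => x * s)%g) /=.
  by rewrite -mulgA -[(s * s)%g]/(s ^+ 2)%g s2 mulg1.
have sX i : (s * r ^+ i = r ^+ (i * m.-1) * s)%g.
  elim: i => [|i IH]; first by rewrite mulg1 mul1g.
  by rewrite expgS mulgA sr -mulgA IH mulgA -expgD mulSn.
elim: j k => [|j IH] k; first by rewrite mulg1 mul1g muln1.
by rewrite expgSr -mulgA sX mulgA IH expnS mulnA mulgA.
Qed.

(** The universal property of the presentation. The normal form of an element of [G] is unique
    modulo m and 2, which defines [phi]; the common commutation rule for normal forms makes it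
    multiplicative. Its value outside [G] is arbitrary. *)
Lemma dihedral_extend (A : pzRingType) (x y : A) :
    x ^+ m = 1 -> y * y = 1 -> y * x * (y * x) = 1 ->
  exists phi : gT -> A,
    (forall i j, phi (r ^+ i * s ^+ j)%g = x ^+ i * y ^+ j) /\
    {in G &, forall g h, phi (g * h)%g = phi g * phi h}.
Proof.
move=> xm y2 yx2.
have yx : y * x = x ^+ m.-1 * y.
  rewrite -[x ^+ m.-1]mul1r -yx2 -(mulrA (y * x)) -(mulrA y x (x ^+ _)) -exprS
    prednK //.
  by rewrite xm mulr1 -(mulrA _ y y) y2 mulr1.
have yX i : y * x ^+ i = x ^+ (i * m.-1) * y.
  elim: i => [|i IH]; first by rewrite mulr1 mul1r.
  by rewrite exprS mulrA yx -mulrA IH mulrA -exprD mulSn.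
have yXX j k : y ^+ j * x ^+ k = x ^+ (k * m.-1 ^ j) * y ^+ j.
  elim: j k => [|j IH] k; first by rewrite mulr1 mul1r muln1.
  by rewrite exprSr -mulrA yX mulrA IH expnS mulnA mulrA.
have x_mod i : x ^+ (i %% m) = x ^+ i.
  by rewrite [in RHS](divn_eq i m) exprD mulnC exprM xm expr1n mul1r.
have y_mod i : y ^+ (i %% 2) = y ^+ i.
  by rewrite [in RHS](divn_eq i 2) exprD mulnC exprM expr2 y2 expr1n mul1r.
have /boolp.choice[phi phiE] (g : gT) : exists z : A,
    forall i j, g = (r ^+ i * s ^+ j)%g -> z = x ^+ i * y ^+ j.
  have [[k [l ->]]|no_kl] := pselect (exists k l, g = (r ^+ k * s ^+ l)%g).
    exists (x ^+ k * y ^+ l) => i j /dihedral_inj[ki lj].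
    by rewrite -(x_mod k) -(y_mod l) ki lj x_mod y_mod.
  by exists 0 => i j E; case: no_kl; exists i, j.
have {}phiE i j : phi (r ^+ i * s ^+ j)%g = x ^+ i * y ^+ j by apply: phiE.
exists phi; split=> // _ _ /dihedral_elt[i [j ->]] /dihedral_elt[k [l ->]].
rewrite !phiE (mulrA _ (x ^+ k)) -(mulrA _ (y ^+ j)) yXX mulrA -exprD -mulrA -exprD.
rewrite -phiE; congr (phi _).
by rewrite (mulgA _ (r ^+ k)%g) -(mulgA _ (s ^+ j)%g) dihedral_commute mulgA -expgD
  -mulgA -expgD.
Qed.

End Dihedral.

(** * Parity of binomial coefficients and integer congruences *)

(** The parity has period 4, because C(k + 4, 2) = C(k, 2) + 4k + 6. *)
Lemma odd_bin2 t : odd 'C(t, 2) = (1 < t %% 4)%N.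
Proof.
rewrite (divn_eq t 4) modnMDl modn_mod; move: (t %/ 4)%N (ltn_pmod t (isT : 0 <
  4)%N) => q.
move: (t %% 4)%N => a a4; elim: q => [|q IH].
  by case: a a4 => [|[|[|[|]]]].
rewrite mulSn -IH -addnA; move: (_ + a)%N => k.
rewrite !(addSn, add0n) !binS !bin1 !bin0 !oddD !oddS /=.
by case: (odd k); case: (odd 'C(k, 2)).
Qed.

Lemma int_congr_nat (K : numDomainType) d (a t : nat) :
  int_congr d a (t%:R : K) <-> t = a %[mod d].
Proof.
split=> [[k]|ta].
  rewrite -[t%:R]/(t%:Z%:~R) => /eqP; rewrite eqr_int => /eqP tE.
  have : (t%:Z = a%:Z %[mod d%:Z])%Z by rewrite tE addrC modzMDl.
  by rewrite !modz_nat => -[].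
exists ((t %/ d)%:Z - (a %/ d)%:Z).
rewrite -[t%:R]/(t%:Z%:~R); congr (_%:~R).
move: (divn_eq t d) (divn_eq a d); rewrite ta.
move: (t %/ d)%N (a %/ d)%N (a %% d)%N => q q' x {ta} -> ->.
by rewrite !PoszD !PoszM; ring.
Qed.

(** * Lifts of representations of dihedral groups *)

Section Lifting.
Variables (K : numClosedFieldType) (m : nat) (gT : finGroupType) (G : {group gT}).
Variables (r s : gT) (n : nat) (rG : mx_representation K G n) (B : 'M[K]_n).
Hypotheses (m_odd : odd m) (dihG : is_dihedral m G r s).
Hypothesis B_nondeg : nondeg_sym B.
Hypothesis rG_orth : forall g, g \in G -> orthogonal_mx B (rG g).

Let B_sym : B^T = B. Proof. by case: B_nondeg. Qed.
Let two_neq0 : (2 : K) != 0. Proof. by rewrite pnatr_eq0. Qed.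
Let m_gt0 : (0 < m)%N. Proof. exact: odd_gt0. Qed.
Let r_in : r \in G. Proof. by have [] := dihedral_gens dihG. Qed.
Let sG : s \in G. Proof. by have [] := dihedral_gens dihG. Qed.

Let rG_involution g : g \in G -> (g * g = 1)%g -> rG g *m rG g = 1%:M.
Proof. by move=> gG g2; rewrite -repr_mxM // g2 repr_mx1. Qed.

Let rG_pow g k : g \in G -> rG (g ^+ k)%g = rG g ^+ k.
Proof.
move=> gG; elim: k => [|k IH]; first by rewrite repr_mx1.
by rewrite expgS repr_mxM ?groupX // IH exprS.
Qed.

Variable e : K.
Hypothesis e_sqr : e * e = 1.

Lemma pin_kernel us : all_norm B e us -> refl_prod B us = 1 ->
  vec_prod B us = 1 \/ vec_prod B us = -1.
Proof.
have id_orth : orthogonal_mx B 1%:M.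
  by split=> [|v]; [exact: unitmx1|rewrite mul1mx].
(* An eigenbasis of the identity is just an orthonormal basis. *)
have [P [_ [PBP _ _]]] := involution_eigenbasis B_nondeg id_orth (mulmx1 _).
exact: (vec_prod_kernel B_sym two_neq0 PBP e_sqr).
Qed.

Definition seq_pow (us : seq 'cV[K]_n) k := flatten (nseq k us).

Lemma vec_prod_pow us k : vec_prod B (seq_pow us k) = vec_prod B us ^+ k.
Proof.
elim: k => [|k IH]; first by rewrite /vec_prod big_nil.
by rewrite [seq_pow _ _]/= vec_prod_cat IH exprS.
Qed.

Lemma refl_prod_pow us k : refl_prod B (seq_pow us k) = refl_prod B us ^+ k.
Proof.
elim: k => [|k IH]; first by rewrite /refl_prod big_nil.
by rewrite [seq_pow _ _]/= refl_prod_cat IH exprS.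
Qed.

Lemma all_norm_pow us k : all_norm B e us -> all_norm B e (seq_pow us k).
Proof. by move=> Qus; elim: k => //= k IH; rewrite all_norm_cat Qus. Qed.

Lemma clifford_1_neqN1 : (1 : clifford B) <> -1.
Proof.
move/eqP; rewrite -subr_eq0 opprK -(rmorph1 (clifford_scal B)) -raddfD /=.
by rewrite clifford_scal_eq0 (negPf two_neq0).
Qed.

(** [phi s] squares to 1 and differs from the product over [us] by a sign, which squaring
    removes. *)
Lemma pin_lift_necessary us : all_norm B e us -> refl_prod B us = rG s ->
  lifts_pin rG B e -> vec_prod B us * vec_prod B us = 1.
Proof.
move=> Qus Rus [p p_cov [phi [phi_pin phiM phi_p]]].
have [_ _ s2 _ _] := dihG.
have [ws Qws phi_s] := pinP B_sym e_sqr (phi_pin s sG).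
(* [phi] is only known to be multiplicative; [phi 1] is idempotent and invertible in Pin. *)
have phi1 : phi 1%g = 1.
  have [vs Qvs phi1] := pinP B_sym e_sqr (phi_pin _ (group1 G)).
  have := phiM _ _ (group1 G) (group1 G); rewrite mulg1.
  rewrite phi1 => /(congr1 (fun x => x * vec_prod B (inv_seq e vs))).
  by rewrite /= -mulrA (vec_prod_inv e_sqr Qvs).1 mulr1 => ->.
have Rws : refl_prod B ws = rG s by rewrite -phi_p // phi_s (pin_coveringE p_cov).
have ws2 : vec_prod B ws * vec_prod B ws = 1.
  by rewrite -phi_s -phiM // -[(s * s)%g]/(s ^+ 2)%g s2.
have [Vinv Vinv'] := vec_prod_inv e_sqr Qus.
have := @pin_kernel (ws ++ inv_seq e us); rewrite all_norm_cat Qws all_norm_inv //.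
rewrite vec_prod_cat refl_prod_cat Rws -Rus (refl_prod_inv B_sym e_sqr Qus).1.
move=> /(_ isT erefl) ker; rewrite -ws2.
have -> : vec_prod B ws = vec_prod B ws * vec_prod B (inv_seq e us) * vec_prod B us.
  by rewrite -mulrA Vinv' mulr1.
by case: ker => ->; rewrite ?mul1r // !mulN1r mulrNN.
Qed.

Lemma pin_lift_sufficient us : all_norm B e us -> refl_prod B us = rG s ->
  vec_prod B us * vec_prod B us = 1 -> lifts_pin rG B e.
Proof.
move=> Qus Rus us2; have [_ rm s2 _ _] := dihG.
have srG : (s * r)%g \in G by rewrite groupM.
have [ws [Qws Rws _ _ _]] := involution_lift B_nondeg (rG_orth srG)
  (rG_involution srG (dihedral_reflection_sqr dihG)) e_sqr.
(* A lift of r = s (s r), from lifts of the two involutions. *)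
pose rs0 := us ++ ws.
have Qrs0 : all_norm B e rs0 by rewrite all_norm_cat Qus.
have Rrs0 : refl_prod B rs0 = rG r.
  rewrite refl_prod_cat Rus Rws -mulmxE -repr_mxM // mulgA.
  by rewrite -[(s * s)%g]/(s ^+ 2)%g s2 mul1g.
have Rpow k : refl_prod B rs0 ^+ k = rG (r ^+ k)%g.
  by rewrite Rrs0 rG_pow.
(* The (m+1)-st power of a lift of [r] is another lift, of order dividing [m]. *)
have [rs [Qrs Rrs xm]] : exists rs, [/\ all_norm B e rs, refl_prod B rs = rG r
    & vec_prod B rs ^+ m = 1].
  exists (seq_pow rs0 m.+1); split; first exact: all_norm_pow.
    by rewrite refl_prod_pow Rpow expgS rm mulg1.
  (* The m-th power of the product over [rs0] is 1 or -1, and m + 1 is even. *)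
  rewrite vec_prod_pow -exprM mulnC exprM.
  have := @pin_kernel (seq_pow rs0 m) (all_norm_pow m Qrs0).
  rewrite refl_prod_pow Rpow rm repr_mx1 vec_prod_pow => /(_ erefl).
  by case=> ->; rewrite ?expr1n // -signr_odd /= m_odd.
set y := vec_prod B us in us2 *; set x := vec_prod B rs in xm *.
have yx2 : y * x * (y * x) = 1.
  have := @pin_kernel ((us ++ rs) ++ (us ++ rs)).
  rewrite !all_norm_cat Qus Qrs !refl_prod_cat Rus Rrs !vec_prod_cat => /(_ isT).
  case=> // [|yx2N].
    by rewrite -!mulmxE -!repr_mxM ?groupM // (dihedral_reflection_sqr dihG)
      repr_mx1.
  (* If (y x)^2 were -1, the conjugate y x y would be minus the inverse of x. Taking m-th powers,
     with m odd, would give 1 = -1. *)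
  have yxyE : y * x * y = - x ^+ m.-1.
    rewrite -mulN1r -yx2N -/x -/y -(mulrA (y * x)) -(mulrA y x (x ^+ _)) -exprS
      prednK //.
    by rewrite xm mulr1.
  have := conj_involution_exp x m us2; rewrite xm mulr1 us2 yxyE exprNn -signr_odd
    m_odd expr1.
  by rewrite -exprM mulnC exprM xm expr1n mulr1 => /esym/clifford_1_neqN1.
have [phi [phiE phiM]] := dihedral_extend dihG m_gt0 xm us2 yx2.
have [p [p_cov pE]] := pin_covering_exists B_sym e_sqr two_neq0.
exists p => //; exists phi; split=> // g /(dihedral_elt dihG)[i [j ->]];
  rewrite phiE /x /y -!vec_prod_pow -vec_prod_cat.
  by apply: pin_vec_prod; rewrite all_norm_cat !all_norm_pow.
rewrite pE ?all_norm_cat ?all_norm_pow // refl_prod_cat !refl_prod_pow Rrs Rus.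
by rewrite -!rG_pow // -mulmxE -repr_mxM ?groupX.
Qed.

(** The square of a lift of pi(s) is a scalar of C(V), and scalars embed, so the criterion becomes
    an equation in [K]. *)
Lemma lifts_pinE : exists t : nat,
  (\tr (rG 1%g) - \tr (rG s)) / 2 = t%:R /\
  (lifts_pin rG B e <-> (-1) ^+ 'C(t, 2) * e ^+ t = 1).
Proof.
have [_ _ s2 _ _] := dihG.
have [us [Qus Rus us2 tr_s _]] :=
  involution_lift B_nondeg (rG_orth sG) (rG_involution sG s2) e_sqr.
exists (size us); split.
  by rewrite repr_mx1 mxtrace1 tr_s opprB addrC subrK mulrAC mulfV // mul1r.
have scalE : vec_prod B us * vec_prod B us =
    clifford_scal B ((-1) ^+ 'C(size us, 2) * e ^+ size us).
  by rewrite us2 rmorphM rmorph_sign.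
split=> [/(pin_lift_necessary Qus Rus)|E]; last first.
  by apply: (pin_lift_sufficient Qus Rus); rewrite scalE E rmorph1.
rewrite scalE => /eqP; rewrite -subr_eq0 -(rmorph1 (clifford_scal B)) -raddfB.
by rewrite clifford_scal_eq0 subr_eq0 => /eqP.
Qed.

(** If det pi(s) = 1, the relation (s r)^2 = 1 gives det pi(r)^2 = 1, while r^m = 1 with m odd then
    leaves only det pi(r) = 1. *)
Lemma dihedral_det1 : \det (rG s) = 1 -> {in G, forall g, \det (rG g) = 1}.
Proof.
move=> det_s; have [_ rm _ _ _] := dihG.
have det_pow g k : g \in G -> \det (rG (g ^+ k)%g) = \det (rG g) ^+ k.
  move=> gG; elim: k => [|k IH]; first by rewrite repr_mx1 det1.
  by rewrite expgS repr_mxM ?groupX // det_mulmx IH exprS.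
have det_r2 : \det (rG r) ^+ 2 = 1.
  have := congr1 (fun g => \det (rG g)) (dihedral_reflection_sqr dihG).
  by rewrite !repr_mxM ?groupM // !det_mulmx repr_mx1 det1 det_s mul1r.
have det_r : \det (rG r) = 1.
  have := det_pow r m r_in; rewrite rm repr_mx1 det1 -(odd_double_half m) m_odd.
  by rewrite exprS -mul2n exprM det_r2 expr1n mulr1.
move=> _ /(dihedral_elt dihG)[i [j ->]].
by rewrite repr_mxM ?groupX // det_mulmx !det_pow // det_r det_s !expr1n mulr1.
Qed.

End Lifting.

(** * The double cover by fourth roots of unity, and the three criteria *)

Lemma sign_eq1 (K : numDomainType) k : ((-1) ^+ k = 1 :> K) <-> ~~ odd k.
Proof.
rewrite -signr_odd; case: odd; split=> //= /eqP.
by rewrite expr1 eq_sym -addr_eq0 -mulr2n pnatr_eq0.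
Qed.

(** For even t the determinant is trivial on G, so the constant second component 1 gives a lift.
    Conversely, a lift of s has second component z with z^2 = 1, and z^2 is the determinant of
    pi(s). *)
Lemma lifts_O_tildeE (R : realType) (m : nat) (gT : finGroupType) (G : {group gT})
    (r s : gT) (n : nat) (rG : mx_representation R[i] G n) (B : 'M[R[i]]_n) :
    odd m -> is_dihedral m G r s -> nondeg_sym B ->
    (forall g, g \in G -> orthogonal_mx B (rG g)) ->
  exists t : nat, (\tr (rG 1%g) - \tr (rG s)) / 2 = t%:R /\
    (lifts_O_tilde rG B <-> ~~ odd t).
Proof.
move=> m_odd dihG B_nondeg rG_orth; have [_ sG] := dihedral_gens dihG.
have [_ _ s2 _ _] := dihG.
have ss : rG s *m rG s = 1%:M by rewrite -repr_mxM // -[(s * s)%g]/(s ^+ 2)%g s2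
  repr_mx1.
have [us [_ _ _ tr_s det_s]] := involution_lift B_nondeg (rG_orth s sG) ss (mulr1
  1).
exists (size us); split.
  by rewrite repr_mx1 mxtrace1 tr_s opprB addrC subrK mulrAC mulfV ?mul1r
    ?pnatr_eq0.
split=> [[phi [phiE phiM phi1]]|t_even]; last first.
  have det1 := dihedral_det1 m_odd dihG (etrans det_s ((sign_eq1 _ _).2 t_even)).
  exists (fun g => (rG g, 1)); split=> [g gG|g h gG hG|//] /=.
    by split=> /=; [exact: rG_orth|exists 0%N|rewrite det1 // expr1n].
  by rewrite /O_tilde_mul /= repr_mxM // mulr1.
apply/(sign_eq1 R[i]); apply: (etrans (esym det_s)); rewrite -phi1 //.
have [_ _ ->] := phiE s sG.
(* z^2 is the second component of [phi 1], which is 1 because it is idempotent and nonzero. *)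
have /(congr1 snd) /= := phiM _ _ sG sG; rewrite -[(s * s)%g]/(s ^+ 2)%g s2 -expr2
  => <-.
have /(congr1 snd) /= := phiM _ _ (group1 G) (group1 G); rewrite mulg1.
have [_ [k zE] _] := phiE _ (group1 G).
have z0 : (phi 1%g).2 != 0 by rewrite zE expf_neq0 // neq0Ci.
by rewrite -[X in X = _]mulr1 => /(mulfI z0).
Qed.

Theorem proposition6p1 (R : realType) (m : nat)
    (gT : finGroupType) (G : {group gT}) (r s : gT)
    (n : nat) (rG : mx_representation R[i] G n) (B : 'M[R[i]]_n)
    (m_odd : odd m) (dihG : is_dihedral m G r s)
    (B_nondeg : nondeg_sym B)
    (rG_orth : forall g, g \in G -> orthogonal_mx B (rG g)) :
  let t : R[i] := (\tr (rG 1%g) - \tr (rG s)) / 2 in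
  [/\ lifts_O_tilde rG B <-> int_congr 2 0 t,
      lifts_pin rG B 1 <-> int_congr 4 0 t \/ int_congr 4 1 t
    & lifts_pin rG B (- 1) <-> int_congr 4 0 t \/ int_congr 4 3 t].
Proof.
move=> t; split.
- have [k [tE ->]] := lifts_O_tildeE m_odd dihG B_nondeg rG_orth.
  by rewrite /t tE (int_congr_nat _ 2 0 k); lia.
- have [k [tE ->]] := lifts_pinE m_odd dihG B_nondeg rG_orth (mulr1 1).
  rewrite /t tE (int_congr_nat _ 4 0 k) (int_congr_nat _ 4 1 k).
  by rewrite expr1n mulr1 (sign_eq1 R[i]) odd_bin2; lia.
have [k [tE ->]] := lifts_pinE m_odd dihG B_nondeg rG_orth (etrans (mulrNN 1 1)
  (mulr1 1)).
rewrite /t tE (int_congr_nat _ 4 0 k) (int_congr_nat _ 4 3 k).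
(* For e = -1 the exponent is C(t, 2) + t; adding t turns the residues 0, 1 modulo 4 into 0, 3. *)
by rewrite -exprD (sign_eq1 R[i]) oddD odd_bin2; lia.
Qed.
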